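(* Let $(X,T)$ be a dynamical system which is $K$-closeable with respect to a linkable set $K\subset\mathrm{Per}(T)$. Then for every $\mu\in\mathcal M_T(X)$ the set of points generic for $\mu$ is dense in the measure center $C_M(T)$.
   Context: A dynamical system $(X,T)$ consists of a complete separable metric space $(X,\rho)$ and a continuous surjection $T\colon X\to X$. $\mathcal M_T(X)$ is the set of $T$-invariant Borel probability measures (weak$*$ topology). The measure center $C_M(T)$ is the complement of the union of all open sets $U$ with $\mu(U)=0$ for every $\mu\in\mathcal M_T(X)$. $\mathcal E(x,n)=\frac1n\sum_{j<n}\delta_{T^jx}$; $x$ is generic for $\mu$ if $\mathcal E(x,n)\to\mu$ weak$*$. $B(x,n,\varepsilon)=\{y:\rho(T^jy,T^jx)<\varepsilon,\ 0\le j<n\}$. A point $x$ is $K$-closeable if for every $\varepsilon>0$, $N>0$ there exist integers $N\le p\le q\le(1+\varepsilon)p$ and $y\in B(x,p,\varepsilon)\cap K$ with $T^qy=y$; $(X,T)$ is $K$-closeable if every ergodic measure has a $K$-closeable generic point. $K\subset\mathrm{Per}(T)$ is linkable if for all $y_1,y_2\in K$, $\varepsilon>0$, $\lambda\in[0,1]$ there exist $p_1,p_2,q_1,q_2\in\mathbb N$ and $z\in K$ with: $T^{q_2}z=z$; $\lambda-\varepsilon\le\frac{p_1}{p_1+p_2}\le\lambda+\varepsilon$; $p_1\le q_1\le(1+\varepsilon)p_1$ and $z\in B(y_1,p_1,\varepsilon)$; $p_2\le q_2-q_1\le(1+\varepsilon)p_2$ and $T^{q_1}z\in B(y_2,p_2,\varepsilon)$.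 *)

(* Defs.v *)
From HB Require Import structures.
From mathcomp Require Import all_boot all_order all_algebra.
From mathcomp Require Import all_classical all_reals all_analysis.
Set Implicit Arguments. Unset Strict Implicit. Unset Printing Implicit Defensive.
Import Order.TTheory GRing.Theory Num.Theory.
Local Open Scope classical_set_scope.
Local Open Scope ring_scope.

Section MetricDynamics.
Variables (R : realType) (X : pointedType) (rho : X -> X -> R).

Definition is_metric : Prop :=
  (forall x y, 0 <= rho x y) /\
  (forall x y, rho x y = 0 <-> x = y) /\
  (forall x y, rho x y = rho y x) /\
  (forall x y z, rho x z <= rho x y + rho y z).

Definition rho_open (U : set X) : Prop :=
  forall x, U x -> exists2 e : R, 0 < e & forall y, rho x y < e -> U y.

Definition rho_cauchy (u : nat -> X) : Prop :=
  forall e : R, 0 < e -> exists N, forall m n, (N <= m)%N -> (N <= n)%N -> rho (u m) (u n) < e.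

Definition rho_complete : Prop :=
  forall u : nat -> X, rho_cauchy u ->
    exists l : X, forall e : R, 0 < e -> exists N, forall n, (N <= n)%N -> rho (u n) l < e.

Definition rho_separable : Prop :=
  exists D : set X, countable D /\
    forall x (e : R), 0 < e -> exists2 y, D y & rho x y < e.

Definition rho_continuous (f : X -> X) : Prop :=
  forall x (e : R), 0 < e -> exists2 d : R, 0 < d & forall y, rho x y < d -> rho (f x) (f y) < e.

Definition rho_continuous_real (f : X -> R) : Prop :=
  forall x (e : R), 0 < e -> exists2 d : R, 0 < d & forall y, rho x y < d -> `|f x - f y| < e.

Definition Borel : measurableType (rho_open).-sigma := g_sigma_algebraType rho_open.

Variable T : X -> X.

Definition invariant_prob (mu : probability Borel R) : Prop :=
  forall A : set Borel, measurable A -> mu (T @^-1` A) = mu A.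

Definition ergodic (mu : probability Borel R) : Prop :=
  invariant_prob mu /\
  forall A : set Borel, measurable A -> T @^-1` A = A ->
    mu A = 0%E \/ mu A = 1%E.

Definition measure_center : set X :=
  ~` [set x | exists U : set X, [/\ rho_open U,
        (forall mu : probability Borel R, invariant_prob mu -> mu U = 0%E) & U x]].

(** x is generic for mu: E(x,n) -> mu weak-* (tested on bounded continuous functions) *)
Definition generic (mu : probability Borel R) (x : X) : Prop :=
  forall f : X -> R, rho_continuous_real f -> (exists M : R, forall y, `|f y| <= M) ->
    (fun n : nat => ((n%:R)^-1 * \sum_(j < n) f (iter j T x))%:E) @ \oo
      --> (\int[mu]_y (f y)%:E)%E.

Definition bowen_ball (x : X) (n : nat) (e : R) : set X :=
  [set y | forall j, (j < n)%N -> rho (iter j T y) (iter j T x) < e].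

Definition Per : set X := [set y | exists q, (0 < q)%N /\ iter q T y = y].

Definition K_closeable_point (K : set X) (x : X) : Prop :=
  forall (e : R) (N : nat), 0 < e -> (0 < N)%N ->
    exists p q : nat, [/\ (N <= p)%N, (p <= q)%N, q%:R <= (1 + e) * p%:R &
      exists y, [/\ bowen_ball x p e y, K y & iter q T y = y]].

Definition K_closeable (K : set X) : Prop :=
  forall mu : probability Borel R, ergodic mu ->
    exists x, generic mu x /\ K_closeable_point K x.

Definition linkable (K : set X) : Prop :=
  K `<=` Per /\
  forall y1 y2, K y1 -> K y2 -> forall (e lam : R), 0 < e -> 0 <= lam <= 1 ->
    exists p1 p2 q1 q2 : nat, (0 < p1)%N /\ (0 < p2)%N /\ (0 < q1)%N /\ (0 < q2)%N /\
      exists z, [/\ K z, iter q2 T z = z,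
        lam - e <= p1%:R / (p1 + p2)%:R <= lam + e,
        [/\ (p1 <= q1)%N, q1%:R <= (1 + e) * p1%:R & bowen_ball y1 p1 e z] &
        [/\ (p2 <= q2 - q1)%N, (q2 - q1)%:R <= (1 + e) * p2%:R &
            bowen_ball y2 p2 e (iter q1 T z)]].

End MetricDynamics.

Arguments Borel {R X} rho.
Arguments invariant_prob {R X} rho T mu.
Arguments ergodic {R X} rho T mu.
Arguments measure_center {R X} rho T _.
Arguments generic {R X} rho T mu x.
Arguments bowen_ball {R X} rho T x n e _.
Arguments Per {X} T _.
Arguments K_closeable_point {R X} rho T K x.
Arguments K_closeable {R X} rho T K.
Arguments linkable {R X} rho T K.

(* Main.v *)
Require Import Defs.
From HB Require Import structures.
From mathcomp Require Import all_boot all_order all_algebra.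
From mathcomp Require Import all_classical all_reals all_analysis.
From mathcomp Require Import measurable_realfun.
From mathcomp Require Import ring lra zify.
Import Order.TTheory GRing.Theory Num.Theory.
Import numFieldNormedType.Exports.
Set Implicit Arguments. Unset Strict Implicit. Unset Printing Implicit Defensive.
Local Open Scope classical_set_scope.
Local Open Scope ring_scope.

(** For a [mu]-typical point [x] the frequencies of visits of [x] to the sets of a countable
    algebra generating the Borel sets and stable under [T^-1] exist by Birkhoff's theorem;
    inner regularity of [mu] makes them countably additive, and the L^2 convergence of the
    averages makes the resulting invariant measure ergodic. Since the integral of [f] against
    this measure is the limit of the Birkhoff averages of [f] at [x], the ergodic measures
    [nu] satisfy [sup_nu int f dnu >= int f dmu] for every bounded measurable [f].

    Closeability transports the averages of a Lipschitz [f] from an ergodic measure to a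
    closed orbit in [K], and linkability makes the set of vectors of averages of finitely
    many Lipschitz functions over such orbits convex up to closure. A bounded set that is
    convex up to closure and meets, up to closure, every half-space whose boundary contains
    [m] is adherent to [m], hence every invariant [mu] is a weak limit of measures carried by
    closed orbits in [K].

    A generic point of [mu] near a point of the measure center is the limit of periodic
    points [w_j] of [K], up to finitely many iterations of [T]: the orbit of [w_0] visits the
    prescribed neighbourhood, and [w_(j+1)] follows [w_j] for a long time and then a closed
    orbit close to [mu] for a much longer one. *)

(** * Upper limits and integrals of bounded measurable functions *)

Section LimitSuperior.
Variable R : realType.
Implicit Types (u v : R^nat) (l M : R).

Lemma bounded_fun_leP (T : Type) (f : T -> R) : bounded_fun f <-> exists M, forall x, `|f x| <= M.
Proof.
split=> [[M [_ fM]]|[M fM]].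
  by exists (M + 1) => x; apply: fM; rewrite ?ltrDl.
by exists M; split=> [|x Mx y _ /=]; [exact: num_real|exact: le_trans (ltW Mx)].
Qed.

Lemma limn_sup_lt u l : bounded_fun u -> limn_sup u < l -> \forall n \near \oo, u n < l.
Proof.
move=> bu; rewrite limn_supE// => /inf_lt -/(_ (ex_intro _ _ (imageT _ 0%N))).
move=> [_ [N _ <-] supN_lt_l]; exists N => // n Nn; apply: le_lt_trans supN_lt_l.
apply: ub_le_sup; last by exists n.
exact/has_ubound_sdrop/bounded_fun_has_ubound.
Qed.

Lemma limn_sup_gt u l : bounded_fun u -> l < limn_sup u ->
  forall N, exists2 n, (N <= n)%N & l < u n.
Proof.
move=> bu; rewrite limn_supE// => l_lt_sup N.
have : l < sups u N.
  by apply: lt_le_trans l_lt_sup _; apply: ge_inf; [exact: bounded_fun_has_lbound_sups|exists N].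
by case/sup_gt => [|_ [n /= Nn <-] l_lt_un]; [exists (u N), N => /=|exists n].
Qed.

Lemma limn_sup_le u l : bounded_fun u -> (\forall n \near \oo, u n <= l) -> limn_sup u <= l.
Proof.
move=> bu [N _ uN]; rewrite leNgt; apply/negP => /(limn_sup_gt bu)/(_ N)[n /uN /= un_le_l].
by rewrite ltNge un_le_l.
Qed.

Lemma limn_sup_ge u l : bounded_fun u -> (\forall n \near \oo, l <= u n) -> l <= limn_sup u.
Proof.
move=> bu ul; rewrite leNgt; apply/negP => /(limn_sup_lt bu) u_lt_l.
by near \oo => n; suff : l < l; [rewrite ltxx|apply: (@le_lt_trans _ _ (u n)); near: n].
Unshelve. all: by end_near. Qed.

Lemma le_limn_sup u v : bounded_fun u -> bounded_fun v ->
  (\forall n \near \oo, u n <= v n) -> limn_sup u <= limn_sup v.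
Proof.
move=> bu bv uv; apply/ler_addgt0Pr => e e0; apply: limn_sup_le => //.
have v_lt : \forall n \near \oo, v n < limn_sup v + e by apply: limn_sup_lt => //; rewrite ltrDl.
by near=> n; apply: (@le_trans _ _ (v n)); [near: n|apply: ltW; near: n].
Unshelve. all: by end_near. Qed.

Lemma normr_limn_sup_le u M : (forall n, `|u n| <= M) -> `|limn_sup u| <= M.
Proof.
move=> uM; have bu : bounded_fun u by apply/bounded_fun_leP; exists M.
rewrite ler_norml; apply/andP; split; [apply: limn_sup_ge|apply: limn_sup_le] => //;
  by apply: nearW => n; have := uM n; rewrite ler_norml => /andP[].
Qed.

Lemma eq_limn_sup u v : bounded_fun u -> bounded_fun v -> u \- v @ \oo --> 0 ->
  limn_sup u = limn_sup v.
Proof.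
suff le_of_dist0 u' v' : bounded_fun u' -> bounded_fun v' -> u' \- v' @ \oo --> 0 ->
    limn_sup u' <= limn_sup v'.
  move=> bu bv uv0; apply/eqP; rewrite eq_le !le_of_dist0//.
  by rewrite -oppr0 (_ : v \- u = \- (u \- v)); [exact: cvgN|apply/funext => n /=; rewrite opprB].
move=> bu bv uv0; have -> : u' = v' \+ (u' \- v') by apply/funext => n /=; rewrite subrKC.
have bd : bounded_fun (u' \- v') by apply: cvg_seq_bounded; apply/cvg_ex; exists 0.
apply: le_trans (le_limn_supD bv bd) _.
by have [_ ->] := cvg_limn_inf_sup uv0; rewrite addr0.
Qed.

Lemma cvg_limn_supN u : bounded_fun u -> limn_sup u + limn_sup (\- u) = 0 ->
  u @ \oo --> limn_sup u.
Proof.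
move=> bu sup0; apply/cvgrPdist_lt => e e0.
have u_lt : \forall n \near \oo, u n < limn_sup u + e by apply: limn_sup_lt; rewrite ?ltrDl.
have Nu_lt : \forall n \near \oo, (\- u) n < limn_sup (\- u) + e.
  by apply: limn_sup_lt; rewrite ?ltrDl//; exact: bounded_funN.
near=> n; rewrite distrC ltr_norml; apply/andP; split; last first.
  by rewrite ltrBlDl; near: n.
have : (\- u) n < limn_sup (\- u) + e by near: n.
by rewrite /=; lra.
Unshelve. all: by end_near. Qed.

End LimitSuperior.

Section BoundedMeasurable.
Context {d : measure_display} {X : measurableType d} {R : realType}.
Implicit Types f g : X -> R.

Definition bounded_mfun g : Prop :=
  measurable_fun setT g /\ bounded_fun g.

Lemma bounded_mfun_cst (c : R) : bounded_mfun (cst c).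
Proof. by split; [exact: measurable_cst|apply/bounded_fun_leP; exists `|c|]. Qed.

Lemma bounded_mfunD f g : bounded_mfun f -> bounded_mfun g -> bounded_mfun (f \+ g).
Proof.
by move=> [mf bf] [mg bg]; split; [exact: measurable_funD|exact: bounded_funD].
Qed.

Lemma bounded_mfunM f g : bounded_mfun f -> bounded_mfun g -> bounded_mfun (f \* g).
Proof.
move=> [mf /bounded_fun_leP[M fM]] [mg /bounded_fun_leP[N gN]].
split; first exact: measurable_funM.
by apply/bounded_fun_leP; exists (M * N) => x; rewrite normrM; apply: ler_pM.
Qed.

Lemma bounded_mfunZ (c : R) f : bounded_mfun f -> bounded_mfun (fun x => c * f x).
Proof. exact/bounded_mfunM/bounded_mfun_cst. Qed.

Lemma bounded_mfunN f : bounded_mfun f -> bounded_mfun (\- f).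
Proof.
by move=> [mf bf]; split; [exact: measurableT_comp|exact: bounded_funN].
Qed.

Lemma bounded_mfunB f g : bounded_mfun f -> bounded_mfun g -> bounded_mfun (f \- g).
Proof. by move=> bf /bounded_mfunN; exact: bounded_mfunD. Qed.

Lemma bounded_mfun_sum (J : Type) (r : seq J) (F : J -> X -> R) :
  (forall i, bounded_mfun (F i)) -> bounded_mfun (fun x => \sum_(i <- r) F i x).
Proof.
move=> bF; elim: r => [|i r bFr].
  by under eq_fun do rewrite big_nil; exact: bounded_mfun_cst.
by under eq_fun do rewrite big_cons; exact: bounded_mfunD.
Qed.

Lemma bounded_mfun_max f g : bounded_mfun f -> bounded_mfun g -> bounded_mfun (f \max g).
Proof.
move=> [mf /bounded_fun_leP[M fM]] [mg /bounded_fun_leP[N gN]].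
split; first exact: measurable_maxr.
apply/bounded_fun_leP.
by exists (Num.max M N) => x /=; have [_|_] := leP (f x) (g x); rewrite le_max ?gN ?fM ?orbT.
Qed.

Lemma normr_indic_le1 (T : Type) (A : set T) x : `|\1_A x : R| <= 1.
Proof. by rewrite indicE; case: (_ \in _); rewrite ?normr0 ?normr1. Qed.

Lemma bounded_fun_indic (T : Type) (A : set T) : bounded_fun (\1_A : T -> R).
Proof. by apply/bounded_fun_leP; exists 1 => x; exact: normr_indic_le1. Qed.

Lemma bounded_mfun_indic (A : set X) : measurable A -> bounded_mfun (\1_A : X -> R).
Proof. by move=> mA; split; [exact: measurable_indic|exact: bounded_fun_indic]. Qed.

Lemma bounded_mfun_comp (t : X -> X) g : measurable_fun setT t -> bounded_mfun g ->
  bounded_mfun (g \o t).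
Proof.
move=> mt [mg /bounded_fun_leP[M gM]]; split; first exact: measurableT_comp.
by apply/bounded_fun_leP; exists M => x; exact: gM.
Qed.

Lemma bounded_mfun_limn_sup (F : X -> R^nat) (M : R) : (forall n, measurable_fun setT (F ^~ n)) ->
  (forall x n, `|F x n| <= M) -> bounded_mfun (fun x => limn_sup (F x)).
Proof.
move=> mF FM; split; last by apply/bounded_fun_leP; exists M => x; exact: normr_limn_sup_le.
have bF x : bounded_fun (F x) by apply/bounded_fun_leP; exists M.
apply: (@measurable_fun_limn_sup _ _ _ _ (fun n => F ^~ n)) => // x _.
  exact/bounded_fun_has_ubound/bF.
exact/bounded_fun_has_lbound/bF.
Qed.

Variable P : probability X R.

Lemma bounded_mfun_integrable g : bounded_mfun g -> P.-integrable setT (EFin \o g).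
Proof.
move=> [mg bg]; apply: measurable_bounded_integrable => //.
by rewrite -ge0_fin_numE ?fin_num_measure.
Qed.

Lemma EFin_Rintegral g : bounded_mfun g -> (\int[P]_x (g x)%:E)%E = (\int[P]_x g x)%:E.
Proof.
by move=> bg; rewrite /Rintegral fineK//; exact/integrable_fin_num/bounded_mfun_integrable.
Qed.

Lemma bounded_RintegralD f g : bounded_mfun f -> bounded_mfun g ->
  \int[P]_x (f x + g x) = \int[P]_x f x + \int[P]_x g x.
Proof. by move=> bf bg; apply: RintegralD => //; exact: bounded_mfun_integrable. Qed.

Lemma bounded_RintegralB f g : bounded_mfun f -> bounded_mfun g ->
  \int[P]_x (f x - g x) = \int[P]_x f x - \int[P]_x g x.
Proof. by move=> bf bg; apply: RintegralB => //; exact: bounded_mfun_integrable. Qed.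

Lemma bounded_RintegralZ (c : R) f : bounded_mfun f -> \int[P]_x (c * f x) = c * \int[P]_x f x.
Proof. by move=> bf; apply: RintegralZl => //; exact: bounded_mfun_integrable. Qed.

Lemma bounded_RintegralN f : bounded_mfun f -> \int[P]_x (- f x) = - \int[P]_x f x.
Proof.
by move=> bf; rewrite -mulN1r -bounded_RintegralZ//; apply: eq_Rintegral => x _; rewrite mulN1r.
Qed.

Lemma Rintegral_probability_cst (c : R) : \int[P]_x c = c.
Proof. by rewrite Rintegral_cst// [X in fine X]probability_setT mulr1. Qed.

Lemma bounded_Rintegral_sum (J : Type) (r : seq J) (F : J -> X -> R) :
  (forall i, bounded_mfun (F i)) ->
  \int[P]_x (\sum_(i <- r) F i x) = \sum_(i <- r) \int[P]_x F i x.
Proof.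
move=> bF; elim: r => [|i r integral_r].
  by under eq_Rintegral do rewrite big_nil; rewrite Rintegral_probability_cst big_nil.
under eq_Rintegral do rewrite big_cons.
by rewrite bounded_RintegralD// ?integral_r ?big_cons//; exact: bounded_mfun_sum.
Qed.

Lemma Rintegral_indic (A : set X) : measurable A -> \int[P]_x (\1_A x) = fine (P A).
Proof. by move=> mA; rewrite /Rintegral integral_indic// setIT. Qed.

Lemma le_bounded_Rintegral f g : bounded_mfun f -> bounded_mfun g -> (forall x, f x <= g x) ->
  \int[P]_x f x <= \int[P]_x g x.
Proof. by move=> bf bg fg; apply: le_Rintegral => //; exact: bounded_mfun_integrable. Qed.

Lemma normr_bounded_Rintegral_le f g : bounded_mfun f -> bounded_mfun g ->
  (forall x, `|f x| <= g x) -> `|\int[P]_x f x| <= \int[P]_x g x.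
Proof.
move=> bf bg fg; have fgP x : - g x <= f x <= g x by rewrite -ler_norml.
rewrite ler_norml -bounded_RintegralN//; apply/andP.
split; apply: le_bounded_Rintegral => //; last by move=> x; have /andP[] := fgP x.
  exact: bounded_mfunN.
by move=> x; have /andP[] := fgP x.
Qed.

Lemma bounded_Rintegral_dist_le f g (c : R) : bounded_mfun f -> bounded_mfun g ->
  (forall x, `|f x - g x| <= c) -> `|\int[P]_x f x - \int[P]_x g x| <= c.
Proof.
move=> bf bg fg; rewrite -bounded_RintegralB// -[leRHS]Rintegral_probability_cst.
by apply: normr_bounded_Rintegral_le; [exact: bounded_mfunB|exact: bounded_mfun_cst|].
Qed.

(* Integrates [`|g| <= e + g ^+ 2 / e]. *)
Lemma Rintegral_le_second_moment h g e : bounded_mfun h -> (forall x, `|h x| <= 1) ->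
  bounded_mfun g -> 0 < e ->
  `|\int[P]_x (h x * g x)| <= e + e^-1 * \int[P]_x g x ^+ 2.
Proof.
move=> bh h1 bg e0; have bgg := bounded_mfunM bg bg.
rewrite -[X in X + _]Rintegral_probability_cst -bounded_RintegralZ//.
rewrite -bounded_RintegralD//; last 2 first.
- exact: bounded_mfun_cst.
- exact: bounded_mfunZ.
apply: normr_bounded_Rintegral_le => [||x]; first exact: bounded_mfunM.
  by apply: bounded_mfunD; [exact: bounded_mfun_cst|exact: bounded_mfunZ].
rewrite normrM; apply: (@le_trans _ _ `|g x|); first by rewrite ler_piMl.
rewrite -(ler_pM2l e0) mulrDr mulrA mulfV ?gt_eqF// mul1r -real_normK ?num_real//.
by have := sqr_ge0 (e - `|g x|); have := mulr_ge0 (ltW e0) (normr_ge0 (g x)); nra.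
Qed.

Lemma bounded_Rintegral_cvg_ae (F : nat -> X -> R) g (M : R) : (forall n, bounded_mfun (F n)) ->
  (forall n x, `|F n x| <= M) -> bounded_mfun g ->
  {ae P, forall x, F n x @[n --> \oo] --> g x} ->
  \int[P]_x F n x @[n --> \oo] --> \int[P]_x g x.
Proof.
move=> bF FM bg Fg.
have EFin_cvg : {ae P, forall x, setT x -> (F n x)%:E @[n --> \oo] --> (g x)%:E}.
  by apply: filterS Fg => x Fgx _; apply: cvg_EFin => //; exact: nearW.
have [_ _ int_cvg] := @dominated_convergence _ _ _ P setT measurableT
  (fun n => EFin \o F n) (EFin \o g) (EFin \o cst M)
  (fun n => proj2 (measurable_EFinP _ _) (bF n).1) (proj2 (measurable_EFinP _ _) bg.1)
  EFin_cvg (bounded_mfun_integrable (bounded_mfun_cst M)) (aeW P (fun x n _ => FM n x)).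
by apply: (fine_cvg (F := \oo)); rewrite -EFin_Rintegral.
Qed.

Lemma ae_eq0_bounded_Rintegral (h : X -> R) : bounded_mfun h -> (forall x, 0 <= h x) ->
  \int[P]_x h x = 0 -> {ae P, forall x, h x = 0}.
Proof.
move=> bh h0 int_h0.
have : (\int[P]_x `|(h x)%:E| = 0)%E.
  by under eq_integral do rewrite gee0_abs ?lee_fin//; rewrite EFin_Rintegral// int_h0.
move/(ae_eq_integral_abs P measurableT (proj2 (measurable_EFinP _ _) bh.1)).
by apply: filterS => x /(_ I)[].
Qed.

Lemma ae_inf_eq0 (h : nat -> X -> R) : (forall n, bounded_mfun (h n)) ->
  (forall n x, 0 <= h n x) -> (forall e, 0 < e -> exists n, \int[P]_x h n x <= e) ->
  {ae P, forall x e, 0 < e -> exists n, h n x < e}.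
Proof.
move=> bh h0 int_small; pose hinf x := infs (h ^~ x) 0%N.
have lb_h x : has_lbound (range (h ^~ x)) by exists 0 => _ [n _ <-].
have lb_drop x := has_lbound_sdrop (lb_h x) 0%N.
have hinf_le n x : hinf x <= h n x by apply: ge_inf; [exact: lb_drop|exists n].
have hinf0 x : 0 <= hinf x.
  by apply: lb_le_inf; [exists (h 0%N x), 0%N|move=> _ [n _ <-]].
have bhinf : bounded_mfun hinf.
  split; first by apply: measurable_fun_infs => // n; case: (bh n).
  have [_ /bounded_fun_leP[M hM]] := bh 0%N.
  apply/bounded_fun_leP; exists M => x; rewrite ger0_norm//.
  by apply: le_trans (hinf_le 0%N x) _; exact: le_trans (ler_norm _) (hM x).
have int_hinf0 : \int[P]_x hinf x = 0.
  apply/eqP; rewrite eq_le Rintegral_ge0// andbT; apply/ler_addgt0Pr => e e0.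
  rewrite add0r; have [n] := int_small _ e0; apply: le_trans.
  exact: le_bounded_Rintegral.
apply: filterS (ae_eq0_bounded_Rintegral bhinf hinf0 int_hinf0) => x hinfx0 e e0.
have [||_ [n _ <-] hn] := @inf_lt _ (sdrop (h ^~ x) 0%N) e; last by exists n.
- by exists (h 0%N x), 0%N.
- by rewrite (hinfx0 : inf _ = 0).
Qed.

Lemma ae_exists_gt (Q : X -> Prop) (g : X -> R) c : {ae P, forall x, Q x} ->
  bounded_mfun g -> c < \int[P]_x g x -> exists2 x, Q x & c < g x.
Proof.
move=> Qae bg c_lt_int; apply: contrapT => /forall2NP no_x.
pose h x := Num.max 0 (g x - c).
have bh : bounded_mfun h.
  by apply/bounded_mfun_max/bounded_mfunB => //; exact: bounded_mfun_cst.
have h0 : ae_eq P setT (EFin \o h) (cst 0).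
  apply: filterS Qae => x Qx _; have [//|/negP] := no_x x; rewrite -leNgt => gx_le_c.
  by congr EFin; apply/max_idPl; rewrite subr_le0.
have int_h0 : \int[P]_x h x = 0.
  have mh : measurable_fun setT (EFin \o h) by apply/measurable_EFinP; case: bh.
  by rewrite /Rintegral (ae_eq_integral (cst 0%E) (EFin \o h) measurableT mh _ h0)// integral0.
have : \int[P]_x (g x - c) <= \int[P]_x h x.
  apply: le_bounded_Rintegral => // [|x]; last by rewrite le_max lexx orbT.
  exact/bounded_mfunB/bounded_mfun_cst.
rewrite int_h0 bounded_RintegralB//; last exact: bounded_mfun_cst.
by rewrite Rintegral_probability_cst subr_le0 leNgt c_lt_int.
Qed.

Lemma ae_forall_countable (I : countType) (Q : I -> X -> Prop) :
  (forall i, {ae P, forall x, Q i x}) -> {ae P, forall x i, Q i x}.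
Proof.
move=> Qae; have : {ae P, forall x n, if unpickle n is Some i then Q i x else True}.
  by apply/ae_foralln => n; case: unpickle => [i|]; [exact: Qae|exact: aeW].
by apply: filterS => x Qx i; have := Qx (pickle i); rewrite pickleK.
Qed.

End BoundedMeasurable.

(** * Birkhoff's ergodic theorem *)

Section BirkhoffSums.
Context {X : Type} {R : realType}.
Variable t : X -> X.
Implicit Types (f g : X -> R) (x : X) (m n : nat) (M : R).

Definition birkhoff_sum g x n : R := \sum_(j < n) g (iter j t x).
Definition birkhoff_avg g x : R^nat := fun n => n%:R^-1 * birkhoff_sum g x n.
Definition birkhoff_limsup g x : R := limn_sup (birkhoff_avg g x).

Definition mean_square_cvg_at g x : Prop := forall e : R, 0 < e ->
  exists n, birkhoff_limsup (fun y => (birkhoff_avg g y n.+1 - birkhoff_limsup g y) ^+ 2) x < e.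

Lemma birkhoff_sum0 g x : birkhoff_sum g x 0 = 0.
Proof. by rewrite /birkhoff_sum big_ord0. Qed.

Lemma birkhoff_sumSr g x n : birkhoff_sum g x n.+1 = birkhoff_sum g x n + g (iter n t x).
Proof. by rewrite /birkhoff_sum big_ord_recr. Qed.

Lemma birkhoff_sumS g x n : birkhoff_sum g x n.+1 = g x + birkhoff_sum g (t x) n.
Proof.
by rewrite /birkhoff_sum big_ord_recl; congr (_ + _); apply: eq_bigr => j _; rewrite -iterSr.
Qed.

Lemma birkhoff_sum_add g x m n :
  birkhoff_sum g x (m + n) = birkhoff_sum g x m + birkhoff_sum g (iter m t x) n.
Proof.
elim: n => [|n sum_mn]; first by rewrite addn0 birkhoff_sum0 addr0.
by rewrite addnS !birkhoff_sumSr sum_mn addrA -iterD addnC.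
Qed.

Lemma birkhoff_sum_mul_period q k g x : iter q t x = x ->
  birkhoff_sum g x (k * q) = k%:R * birkhoff_sum g x q.
Proof.
move=> qx; elim: k => [|k sum_kq]; first by rewrite birkhoff_sum0 mul0r.
by rewrite mulSn birkhoff_sum_add qx sum_kq -add1n natrD mulrDl mul1r.
Qed.

Lemma birkhoff_sum_divn q g x n : iter q t x = x ->
  birkhoff_sum g x n = (n %/ q)%:R * birkhoff_sum g x q + birkhoff_sum g x (n %% q).
Proof.
move=> qx; rewrite {1}(divn_eq n q) birkhoff_sum_add birkhoff_sum_mul_period//.
by rewrite iterM iter_fix.
Qed.

Lemma birkhoff_avgK g x n : (0 < n)%N -> n%:R * birkhoff_avg g x n = birkhoff_sum g x n.
Proof. by move=> n0; rewrite mulVKf// pnatr_eq0 -lt0n. Qed.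

Lemma birkhoff_avgD f g x : birkhoff_avg (f \+ g) x = birkhoff_avg f x \+ birkhoff_avg g x.
Proof. by apply/funext => n; rewrite /birkhoff_avg /birkhoff_sum big_split mulrDr. Qed.

Lemma birkhoff_avgZ (c : R) g x :
  birkhoff_avg (fun y => c * g y) x = (fun n => c * birkhoff_avg g x n).
Proof. by apply/funext => n; rewrite /birkhoff_avg /birkhoff_sum -mulr_sumr mulrCA. Qed.

Lemma birkhoff_avgN g x : birkhoff_avg (\- g) x = \- birkhoff_avg g x.
Proof. by apply/funext => n; rewrite /birkhoff_avg /birkhoff_sum sumrN mulrN. Qed.

Lemma birkhoff_avg_sum (J : Type) (r : seq J) (F : J -> X -> R) x :
  birkhoff_avg (fun y => \sum_(i <- r) F i y) x =
  (fun n => \sum_(i <- r) birkhoff_avg (F i) x n).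
Proof. by apply/funext => n; rewrite /birkhoff_avg /birkhoff_sum exchange_big mulr_sumr. Qed.

Lemma birkhoff_avg_cst (c : R) x n : (0 < n)%N -> birkhoff_avg (cst c) x n = c.
Proof.
move=> n0; rewrite /birkhoff_avg /birkhoff_sum sumr_const card_ord -[c *+ _]mulr_natl.
by rewrite mulKf// pnatr_eq0 -lt0n.
Qed.

Lemma birkhoff_avg_cst_cvg (c : R) x : birkhoff_avg (cst c) x @ \oo --> c.
Proof.
by apply: cvg_near_cst; exists 1%N => // n n1; exact: birkhoff_avg_cst.
Qed.

Lemma le_birkhoff_avg f g x n : (forall y, f y <= g y) ->
  birkhoff_avg f x n <= birkhoff_avg g x n.
Proof.
by move=> fg; rewrite /birkhoff_avg ler_wpM2l ?invr_ge0//; apply: ler_sum => j _; exact: fg.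
Qed.

Lemma normr_birkhoff_sum_le g x n M : (forall y, `|g y| <= M) ->
  `|birkhoff_sum g x n| <= M * n%:R.
Proof.
move=> gM; apply: le_trans (ler_norm_sum _ _ _) _.
apply: le_trans (ler_sum _ (fun i _ => gM _)) _.
by rewrite sumr_const card_ord mulr_natr.
Qed.

Lemma normr_birkhoff_avg_le g x n M : (forall y, `|g y| <= M) -> `|birkhoff_avg g x n| <= M.
Proof.
move=> gM; rewrite normrM ger0_norm ?invr_ge0//.
case: n => [|n]; first by rewrite invr0 mul0r; exact: le_trans (gM x).
by rewrite ler_pdivrMl ?ltr0Sn// mulrC; exact: normr_birkhoff_sum_le.
Qed.

Lemma bounded_birkhoff_avg g x : bounded_fun g ->
  bounded_fun (birkhoff_avg g x).
Proof.
move=> /bounded_fun_leP[M gM]; apply/bounded_fun_leP.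
by exists M => n; exact: normr_birkhoff_avg_le.
Qed.

Lemma normr_birkhoff_limsup_le g x M : (forall y, `|g y| <= M) -> `|birkhoff_limsup g x| <= M.
Proof. by move=> gM; apply: normr_limn_sup_le => n; exact: normr_birkhoff_avg_le. Qed.

Lemma birkhoff_avg_shift_cvg g x : bounded_fun g ->
  birkhoff_avg g (t x) \- birkhoff_avg g x @ \oo --> 0.
Proof.
move=> /bounded_fun_leP[M gM]; have bdry_cvg : (fun n => n%:R^-1 * (2 * M)) @ \oo --> (0 : R).
  rewrite -[X in _ --> X](mul0r (2 * M)); apply: cvgM; last exact: cvg_cst.
  by rewrite -cvg_shiftS; exact: cvg_harmonic.
apply: (squeeze_cvgr (f := fun n => - (n%:R^-1 * (2 * M))) (h := fun n => n%:R^-1 * (2 * M))).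
- apply: nearW => n; rewrite -ler_norml /= /birkhoff_avg -mulrBr normrM ger0_norm ?invr_ge0//.
  rewrite ler_wpM2l ?invr_ge0//.
  have -> : birkhoff_sum g (t x) n - birkhoff_sum g x n = g (iter n t x) - g x.
    by have := birkhoff_sumSr g x n; rewrite birkhoff_sumS; lra.
  apply: le_trans (ler_normB _ _) _.
  by have := gM x; have := gM (iter n t x); lra.
- by rewrite -oppr0; exact: cvgN.
- exact: bdry_cvg.
Qed.

Lemma birkhoff_limsup_comp g x : bounded_fun g ->
  birkhoff_limsup g (t x) = birkhoff_limsup g x.
Proof.
move=> bg; apply: eq_limn_sup; [exact: bounded_birkhoff_avg..|].
exact: birkhoff_avg_shift_cvg.
Qed.

Lemma birkhoff_limsup_iter g x j : bounded_fun g ->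
  birkhoff_limsup g (iter j t x) = birkhoff_limsup g x.
Proof. by move=> bg; elim: j => //= j <-; rewrite birkhoff_limsup_comp. Qed.

Lemma birkhoff_limsupE g x (l : R) : birkhoff_avg g x @ \oo --> l -> birkhoff_limsup g x = l.
Proof. by move=> /cvg_limn_inf_sup[_]. Qed.

Lemma le_birkhoff_limsup f g x :
  bounded_fun f -> bounded_fun g ->
  (forall y, f y <= g y) -> birkhoff_limsup f x <= birkhoff_limsup g x.
Proof.
move=> bf bg fg; apply: le_limn_sup; [exact: bounded_birkhoff_avg..|].
by apply: nearW => n; exact: le_birkhoff_avg.
Qed.

Lemma birkhoff_limsup_ge0 f x : bounded_fun f -> (forall y, 0 <= f y) ->
  0 <= birkhoff_limsup f x.
Proof.
move=> bf f0; apply: limn_sup_ge; first exact: bounded_birkhoff_avg.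
by apply: nearW => n; rewrite mulr_ge0 ?invr_ge0//; apply: sumr_ge0.
Qed.

Lemma birkhoff_limsupD_le f g x :
  bounded_fun f -> bounded_fun g ->
  birkhoff_limsup (f \+ g) x <= birkhoff_limsup f x + birkhoff_limsup g x.
Proof.
by move=> bf bg; rewrite /birkhoff_limsup birkhoff_avgD; apply: le_limn_supD;
  exact: bounded_birkhoff_avg.
Qed.

Lemma birkhoff_limsup_indic0 x : birkhoff_limsup (\1_set0) x = 0.
Proof.
have -> : \1_set0 = cst 0 :> (X -> R) by exact: indic0.
exact: birkhoff_limsupE (birkhoff_avg_cst_cvg x).
Qed.

Lemma birkhoff_limsup_indic_le (A B : set X) x : A `<=` B ->
  birkhoff_limsup (\1_A) x <= birkhoff_limsup (\1_B) x.
Proof.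
move=> AB; apply: le_birkhoff_limsup => [||y]; [exact: bounded_fun_indic..|].
rewrite !indicE; have [/set_mem/AB By|//] := boolP (y \in A).
by rewrite mem_set.
Qed.

Lemma birkhoff_limsup_bigcup_le (D : nat -> set X) n x :
  birkhoff_limsup (\1_(\bigcup_(i < n) D i)) x <= \sum_(i < n) birkhoff_limsup (\1_(D i)) x.
Proof.
elim: n => [|n IHn]; first by rewrite big_ord0 bigcup_mkord big_ord0 birkhoff_limsup_indic0.
rewrite big_ord_recr /=; apply: le_trans (lerD IHn (lexx _)).
have bindic A : bounded_fun (\1_A : X -> R) by exact: bounded_fun_indic.
apply: le_trans (birkhoff_limsupD_le _ (bindic _) (bindic _)).
apply: le_birkhoff_limsup => [||y]; [exact: bindic|exact: bounded_funD|].
rewrite /= !indicE bigcup_mkord big_ord_recr /= -bigcup_mkord in_setU.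
by case: (_ \in _); case: (_ \in _); rewrite /= ?addr0 ?add0r// lerDl.
Qed.

End BirkhoffSums.

Section ErgodicTheorem.
Context {d : measure_display} {X : measurableType d} {R : realType}.
Variables (P : probability X R) (t : X -> X).
Hypothesis mt : measurable_fun setT t.
Hypothesis tP : forall A, measurable A -> P (t @^-1` A) = P A.
Implicit Types g h : X -> R.

Local Notation S := (birkhoff_sum t).
Local Notation avg := (birkhoff_avg t).
Local Notation limsup := (birkhoff_limsup t).

Lemma measurable_iter j : measurable_fun setT (iter j t).
Proof. by elim: j => [|j mj]; [exact: measurable_id|exact: measurableT_comp mt mj]. Qed.

Lemma bounded_mfun_birkhoff_sum n g : bounded_mfun g -> bounded_mfun (S g ^~ n).
Proof.
by move=> bg; apply: bounded_mfun_sum => j; apply: bounded_mfun_comp => //; exact: measurable_iter.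
Qed.

Lemma bounded_mfun_birkhoff_avg n g : bounded_mfun g -> bounded_mfun (avg g ^~ n).
Proof. by move=> bg; exact/bounded_mfunZ/bounded_mfun_birkhoff_sum. Qed.

Lemma bounded_mfun_birkhoff_limsup g : bounded_mfun g -> bounded_mfun (limsup g).
Proof.
move=> bg; have [_ /bounded_fun_leP[M gM]] := bg.
apply: (@bounded_mfun_limn_sup _ _ _ (avg g) M) => [n|x n]; last exact: normr_birkhoff_avg_le.
by have [] := bounded_mfun_birkhoff_avg n bg.
Qed.

Lemma Rintegral_comp_preserving g : bounded_mfun g -> \int[P]_x g (t x) = \int[P]_x g x.
Proof.
move=> bg; congr fine.
have := @integral_pushforward _ _ X X R t mt P setT (EFin \o g)
  (proj2 (measurable_EFinP _ _) bg.1) _ measurableT.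
rewrite preimage_setT => /(_ (bounded_mfun_integrable P (bounded_mfun_comp mt bg))) /= <-.
by apply: eq_measure_integral => A mA _; exact: tP.
Qed.

Lemma Rintegral_iter_preserving g j : bounded_mfun g ->
  \int[P]_x g (iter j t x) = \int[P]_x g x.
Proof.
move=> bg; elim: j => // j <-; under eq_Rintegral do rewrite iterSr.
apply: (@Rintegral_comp_preserving (g \o iter j t)).
by apply: bounded_mfun_comp => //; exact: measurable_iter.
Qed.

Lemma Rintegral_mul_birkhoff_avg h g n : bounded_mfun h -> h \o t = h -> bounded_mfun g ->
  (0 < n)%N -> \int[P]_x (h x * avg g x n) = \int[P]_x (h x * g x).
Proof.
move=> bh ht bg n0; have bhg := bounded_mfunM bh bg.
have h_iter j x : h (iter j t x) = h x by elim: j => //= j <-; rewrite -[in RHS]ht.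
transitivity (\int[P]_x (n%:R^-1 * \sum_(j < n) h (iter j t x) * g (iter j t x))).
  apply: eq_Rintegral => x _; rewrite mulrCA mulr_sumr.
  by under [in RHS]eq_bigr do rewrite h_iter.
have bhg_iter (j : 'I_n) : bounded_mfun (fun x => h (iter j t x) * g (iter j t x)).
  exact: (bounded_mfun_comp (measurable_iter j) bhg).
rewrite bounded_RintegralZ; last exact: bounded_mfun_sum.
rewrite bounded_Rintegral_sum//.
under eq_bigr do rewrite (Rintegral_iter_preserving _ bhg).
by rewrite sumr_const card_ord -[X in _ * X]mulr_natl mulKf// pnatr_eq0 -lt0n.
Qed.

Fixpoint max_birkhoff_sum h N : X -> R :=
  if N is N'.+1 then fun x => Num.max 0 (h x + max_birkhoff_sum h N' (t x)) else cst 0.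

Lemma max_birkhoff_sum_ge0 h N x : 0 <= max_birkhoff_sum h N x.
Proof. by case: N => //= N; rewrite le_max lexx. Qed.

Lemma bounded_mfun_max_birkhoff_sum h N : bounded_mfun h -> bounded_mfun (max_birkhoff_sum h N).
Proof.
move=> bh; elim: N => [|N bN] /=; first exact: bounded_mfun_cst.
apply: (@bounded_mfun_max _ _ _ (cst 0)); first exact: bounded_mfun_cst.
by apply: bounded_mfunD => //; exact: bounded_mfun_comp.
Qed.

Lemma nondecreasing_max_birkhoff_sum h x : nondecreasing_seq (fun N => max_birkhoff_sum h N x).
Proof.
apply/nondecreasing_seqP => N.
elim: N x => [|N le_N] x; first exact: max_birkhoff_sum_ge0.
by rewrite [leLHS]/= [leRHS]/= ge_max le_max lexx le_max lerD2l le_N orbT.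
Qed.

Lemma birkhoff_sum_le_max h n x : S h x n <= max_birkhoff_sum h n x.
Proof.
elim: n x => [|n le_n] x; first by rewrite birkhoff_sum0.
by rewrite birkhoff_sumS /= le_max lerD2l le_n orbT.
Qed.

Definition max_sum_gt0 h N : set X := [set x | 0 < max_birkhoff_sum h N x].

Lemma measurable_max_sum_gt0 h N : bounded_mfun h -> measurable (max_sum_gt0 h N).
Proof.
move=> bh; rewrite (_ : max_sum_gt0 h N = setT `&` max_birkhoff_sum h N @^-1` `]0, +oo[).
  by apply: (bounded_mfun_max_birkhoff_sum N bh).1 => //; exact: measurable_itv.
by rewrite setTI; apply/seteqP; split=> x; rewrite /max_sum_gt0/= in_itv /= andbT.
Qed.

Lemma max_birkhoff_sum_drift h N x :
  max_birkhoff_sum h N x - max_birkhoff_sum h N (t x) <= h x * \1_(max_sum_gt0 h N) x.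
Proof.
rewrite indicE; have [/set_mem|/negP xN] := boolP (x \in max_sum_gt0 h N); last first.
  rewrite mulr0 subr_le0; apply: le_trans (max_birkhoff_sum_ge0 _ _ _).
  by rewrite leNgt; apply/negP => x_pos; apply: xN; rewrite inE.
rewrite mulr1 lerBlDr /max_sum_gt0 /=; case: N => [|N] /=; first by rewrite ltxx.
rewrite lt_max ltxx /= => hx_pos.
have := nondecreasing_max_birkhoff_sum h (t x) (leqnSn N).
rewrite [max_birkhoff_sum h N.+1 _]/=; set a := Num.max 0 (h (t x) + _) => le_a.
by rewrite ge_max; apply/andP; split; lra.
Qed.

(* Garsia: the drift of [max_birkhoff_sum h N] along [t] has integral zero. *)
Lemma maximal_ergodic h : bounded_mfun h -> (forall x, exists n, 0 < S h x n) ->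
  0 <= \int[P]_x h x.
Proof.
move=> bh sum_pos; have mE N := measurable_max_sum_gt0 N bh.
have bhE N : bounded_mfun (fun x => h x * \1_(max_sum_gt0 h N) x).
  exact/bounded_mfunM/bounded_mfun_indic.
have int_pos_ge0 N : 0 <= \int[P]_x (h x * \1_(max_sum_gt0 h N) x).
  have bN := bounded_mfun_max_birkhoff_sum N bh; have bNt := bounded_mfun_comp mt bN.
  have -> : 0 = \int[P]_x (max_birkhoff_sum h N x - max_birkhoff_sum h N (t x)).
    by rewrite bounded_RintegralB// Rintegral_comp_preserving// subrr.
  by apply: le_bounded_Rintegral (bounded_mfunB bN bNt) (bhE N) _; exact: max_birkhoff_sum_drift.
have int_cvg : \int[P]_x (h x * \1_(max_sum_gt0 h N) x) @[N --> \oo] --> \int[P]_x h x.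
  have [_ /bounded_fun_leP[M hM]] := bh.
  apply: (@bounded_Rintegral_cvg_ae _ _ _ _ _ _ M) => // [N x|].
    by rewrite normrM -[leRHS]mulr1 ler_pM// normr_indic_le1.
  apply: aeW => x; have [n sum_n] := sum_pos x.
  apply: cvg_near_cst; exists n => // m nm; rewrite indicE mem_set ?mulr1//.
  apply: lt_le_trans (nondecreasing_max_birkhoff_sum h x nm).
  exact: lt_le_trans sum_n (birkhoff_sum_le_max _ _ _).
rewrite -(cvg_lim _ int_cvg)//; apply: limr_ge; last exact: nearW.
by apply/cvg_ex; exists (\int[P]_x h x).
Qed.

Lemma Rintegral_birkhoff_limsup_le g : bounded_mfun g -> \int[P]_x limsup g x <= \int[P]_x g x.
Proof.
move=> bg; apply/ler_addgt0Pr => e e0; have [_ bg_ex] := bg.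
have blim := bounded_mfun_birkhoff_limsup bg; have bB := bounded_mfunB bg blim.
have be : bounded_mfun (cst e : X -> R) by exact: bounded_mfun_cst.
pose h x := g x - limsup g x + e.
have : 0 <= \int[P]_x h x.
  apply: maximal_ergodic => [|x]; first exact: bounded_mfunD.
  have [n n0 avg_n] : exists2 n, (0 < n)%N & limsup g x - e < avg g x n.
    apply: (@limn_sup_gt _ (avg g x)); first exact: bounded_birkhoff_avg.
    by rewrite -/(limsup g x); lra.
  exists n; suff -> : S h x n = n%:R * (avg g x n - limsup g x + e).
    by rewrite mulr_gt0 ?ltr0n//; lra.
  rewrite /birkhoff_sum /h.
  under eq_bigr => i _ do rewrite birkhoff_limsup_iter// -addrA.
  rewrite big_split /= -/(S g x n) -(birkhoff_avgK t g x n0) sumr_const card_ord.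
  rewrite -[X in _ + X]mulr_natl.
  by rewrite -mulrDr addrA.
by rewrite bounded_RintegralD// bounded_RintegralB// Rintegral_probability_cst; lra.
Qed.

Theorem birkhoff g : bounded_mfun g -> \int[P]_x limsup g x = \int[P]_x g x /\
  {ae P, forall x, avg g x @ \oo --> limsup g x}.
Proof.
move=> bg; have bNg := bounded_mfunN bg.
have [_ bg_ex] := bg; have [_ bNg_ex] := bNg.
have blim := bounded_mfun_birkhoff_limsup bg; have blimN := bounded_mfun_birkhoff_limsup bNg.
have limN_ge0 x : 0 <= limsup g x + limsup (\- g) x.
  apply: le_trans (birkhoff_limsupD_le _ _ bg_ex bNg_ex).
  have -> : g \+ \- g = cst 0 by apply/funext => y /=; rewrite subrr.
  by rewrite (birkhoff_limsupE (birkhoff_avg_cst_cvg t x)).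
have int_le := Rintegral_birkhoff_limsup_le bg.
have int_leN := Rintegral_birkhoff_limsup_le bNg; rewrite bounded_RintegralN// in int_leN.
have int_ge0 : 0 <= \int[P]_x (limsup g x + limsup (\- g) x) by exact: Rintegral_ge0.
have int_eq0 : \int[P]_x (limsup g x + limsup (\- g) x) = 0.
  by move: int_ge0; rewrite bounded_RintegralD//; lra.
split; first by move: int_eq0; rewrite bounded_RintegralD//; lra.
apply: filterS (ae_eq0_bounded_Rintegral (bounded_mfunD blim blimN) limN_ge0 int_eq0) => x lim0.
apply: cvg_limn_supN; first exact: bounded_birkhoff_avg.
by rewrite -birkhoff_avgN.
Qed.

Lemma birkhoff_L2 g : bounded_mfun g ->
  \int[P]_x (avg g x n - limsup g x) ^+ 2 @[n --> \oo] --> 0.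
Proof.
move=> bg; have [_ /bounded_fun_leP[M gM]] := bg; have blim := bounded_mfun_birkhoff_limsup bg.
rewrite -[X in _ --> X](Rintegral_probability_cst P).
have [_ avg_cvg] := birkhoff bg.
apply: (@bounded_Rintegral_cvg_ae _ _ _ _ _ _ ((2 * M) ^+ 2)) => [n|n x||].
- by apply: bounded_mfunM; apply: bounded_mfunB => //; exact: bounded_mfun_birkhoff_avg.
- rewrite normrX lerXn2r ?nnegrE//; first by rewrite mulr_ge0// (le_trans _ (gM x)).
  apply: le_trans (ler_normB _ _) _.
  by have := normr_birkhoff_avg_le t x n gM; have := normr_birkhoff_limsup_le t x gM; lra.
- exact: bounded_mfun_cst.
apply: filterS avg_cvg => x avg_x.
have dist0 : avg g x n - limsup g x @[n --> \oo] --> 0.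
  by rewrite -(subrr (limsup g x)); apply: cvgB => //; exact: cvg_cst.
by rewrite -[X in _ --> X](mulr0 (0 : R)); exact: (cvgM dist0 dist0).
Qed.

Lemma ae_mean_square_cvg_at g : bounded_mfun g -> {ae P, forall x, mean_square_cvg_at t g x}.
Proof.
move=> bg; pose q n y := (avg g y n.+1 - limsup g y) ^+ 2.
have bq n : bounded_mfun (q n).
  apply: bounded_mfunM; apply: bounded_mfunB;
    (exact: bounded_mfun_birkhoff_avg || exact: bounded_mfun_birkhoff_limsup).
apply: (@ae_inf_eq0 _ _ _ _ (fun n => limsup (q n))) => [n|n x|e e0].
- exact: bounded_mfun_birkhoff_limsup.
- by apply: birkhoff_limsup_ge0 => [|y]; [case: (bq n)|exact: sqr_ge0].
have := birkhoff_L2 bg; rewrite -cvg_shiftS => /cvgr0Pnorm_lt/(_ _ e0)[n _ int_lt].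
exists n; have [-> _] := birkhoff (bq n).
exact: le_trans (ler_norm _) (ltW (int_lt n (leqnn n))).
Qed.

End ErgodicTheorem.

(** * Inner regularity by compact sets *)

Section SmallSets.
Context {d : measure_display} {X : measurableType d} {R : realType}.
Implicit Types (F : (set X)^nat) (e : R).

Definition bigcup_tail {Y : Type} (F : (set Y)^nat) n : set Y :=
  \bigcup_i F i `\` \bigcup_(i < n) F i.

Lemma nonincreasing_bigcup_tail (Y : Type) (F : (set Y)^nat) : nonincreasing_seq (bigcup_tail F).
Proof.
apply/nonincreasing_seqP => n; apply/subsetPset => x [Fx notFx]; split=> // -[i /= ni Fi].
by apply: notFx; exists i => //=; exact: leqW.
Qed.

Lemma bigcap_bigcup_tail (Y : Type) (F : (set Y)^nat) : \bigcap_n bigcup_tail F n = set0.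
Proof.
rewrite -subset0 => x tail_x; have [[i _ Fi] _] := tail_x 0%N I.
by have [_] := tail_x i.+1 I; apply; exists i => /=.
Qed.

Lemma measurable_bigcup_tail F n : (forall i, measurable (F i)) -> measurable (bigcup_tail F n).
Proof. by move=> mF; apply: measurableD; exact: bigcup_measurable. Qed.

Variable P : probability X R.

Lemma probability_nonincreasing_small F e : (forall n, measurable (F n)) ->
  nonincreasing_seq F -> \bigcap_n F n = set0 -> 0 < e -> exists n, (P (F n) <= e%:E)%E.
Proof.
move=> mF ndF F0 e0.
have := nonincreasing_cvg_mu _ mF (bigcapT_measurable mF) ndF (mu := P).
rewrite F0 measure0 -ge0_fin_numE ?fin_num_measure// => /(_ isT)/fine_cvgP[_].
move=> /cvgr0Pnorm_lt/(_ _ e0)[N _ /(_ N (leqnn N)) /= FN]; exists N.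
rewrite -[P _]fineK ?fin_num_measure// lee_fin.
exact: le_trans (ler_norm _) (ltW FN).
Qed.

Lemma probability_bigcup_le F e : 0 <= e -> (forall n, measurable (F n)) ->
  (forall n, (P (F n) <= (e / (2 ^ n.+1)%:R)%:E)%E) -> (P (\bigcup_n F n) <= e%:E)%E.
Proof.
move=> e0 mF Fe.
apply: le_trans (measure_sigma_subadditive P mF _ (@subset_refl _ _)) _.
  exact: bigcup_measurable.
by apply: le_trans (lee_nneseries _ _) (epsilon_trick0 xpredT e0) => // n _; exact: Fe.
Qed.

Lemma probabilityU_le (A B C : set X) e : measurable A -> measurable B -> measurable C ->
  A `<=` B `|` C -> (P B <= (e / 2)%:E)%E -> (P C <= (e / 2)%:E)%E -> (P A <= e%:E)%E.
Proof.
move=> mA mB mC ABC PB PC; apply: (@le_trans _ _ (P (B `|` C))).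
  by apply: le_measure; rewrite ?inE//; exact: measurableU.
apply: le_trans (measureU2 _ _ _) _ => //.
by rewrite [e in leRHS]splitr EFinD leeD.
Qed.

End SmallSets.

Section MetricSpace.
Variables (R : realType) (X : pointedType) (rho : X -> X -> R).

Definition metric_space of is_metric rho : Type := X.

Hypothesis rhoM : is_metric rho.

Lemma rho_ge0 x y : 0 <= rho x y. Proof. by case: rhoM. Qed.
Lemma rhoxx x : rho x x = 0. Proof. by case: rhoM => _ [+ _] => /(_ x x)[_ ->]. Qed.
Lemma rhoC x y : rho x y = rho y x. Proof. by case: rhoM => _ [_ []]. Qed.
Lemma rho_triangle x y z : rho x z <= rho x y + rho y z.
Proof. by case: rhoM => _ [_ [_]]. Qed.
Let rho_eq0 x y : rho x y = 0 -> x = y.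
Proof. by case: rhoM => _ [+ _] => /(_ x y)[]. Qed.

HB.instance Definition _ := Pointed.on (metric_space rhoM).
HB.instance Definition _ := isMetric.Build R (metric_space rhoM)
  rhoxx rho_eq0 rhoC (fun x y z => rho_triangle y x z).

Local Notation M := (metric_space rhoM).

Lemma rho_openE : rho_open rho = @open M.
Proof.
rewrite openE; apply/seteqP; split=> [U oU x /oU[e e0 eU]|U oU x /oU /nbhs_ballP[e e0 eU]].
  by apply/nbhs_ballP; exists e.
by exists e.
Qed.

Lemma open_rho_ball x r : open ([set y | rho x y < r] : set M).
Proof.
rewrite -rho_openE => y /= xy; exists (r - rho x y); first by lra.
by move=> z yz; have := rho_triangle x y z; lra.
Qed.

Lemma closed_rho_ball x r : closed ([set y | rho x y <= r] : set M).
Proof.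
rewrite -openC -rho_openE => y /= /negP; rewrite -ltNge => ry; exists (rho x y - r); first by lra.
move=> z yz; apply/negP; rewrite -ltNge.
by have := rho_triangle x z y; rewrite (rhoC z y); lra.
Qed.

Lemma closed_deep_interior (U : set X) r : closed ([set x | forall y, rho x y < r -> U y] : set M).
Proof.
rewrite -openC -rho_openE => x /= /existsNP[y /not_implyP[xy notUy]].
exists (r - rho x y); first by lra.
move=> z xz; apply/existsNP; exists y; apply/not_implyP; split=> //.
by have := rho_triangle z x y; rewrite (rhoC z x); lra.
Qed.

Lemma measurable_rho_open (U : set M) : open U -> measurable (U : set (Borel rho)).
Proof. by rewrite -rho_openE; exact: sub_sigma_algebra. Qed.

Lemma measurable_rho_closed (F : set M) : closed F -> measurable (F : set (Borel rho)).
Proof.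
move=> /closed_openC/measurable_rho_open mFC.
by rewrite -[F]setCK; exact: (@measurableC _ (Borel rho)).
Qed.

Lemma measurable_rho_compact (C : set M) : compact C -> measurable (C : set (Borel rho)).
Proof. by move=> /(compact_closed (@metric_hausdorff _ M)); exact: measurable_rho_closed. Qed.

Hypothesis rhoX : rho_complete rho.

Lemma rho_complete_cvg (F : set_system M) : ProperFilter F -> cauchy_ex F -> cvg F.
Proof.
move=> FF cauchyF.
have small_ball n : exists x, F (ball x n.+1%:R^-1) by apply: cauchyF; rewrite invr_gt0.
have [u Fu] := choice small_ball.
have dist_u m n : rho (u m) (u n) < m.+1%:R^-1 + n.+1%:R^-1.
  have [x [um un]] := filter_ex (filterI (Fu m) (Fu n)).
  apply: le_lt_trans (rho_triangle _ x _) _; rewrite (rhoC x); exact: ltrD um un.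
have [l ul] : exists l, forall e, 0 < e -> exists N, forall n, (N <= n)%N -> rho (u n) l < e.
  apply: rhoX => e e0; have e20 : 0 < e / 2 by rewrite divr_gt0.
  have [N _ N_lt] := near_infty_natSinv_lt (PosNum e20).
  exists N => m n /N_lt /= m_lt /N_lt /= n_lt.
  by apply: lt_trans (dist_u m n) _; rewrite [e]splitr ltrD.
apply/cvg_ex; exists l; apply/fcvg_ballP => e e0; have e20 : 0 < e / 2 by rewrite divr_gt0.
have [N _ N_lt] := near_infty_natSinv_lt (PosNum e20); have [N' N'_lt] := ul _ e20.
pose n := maxn N N'; have n_lt : n.+1%:R^-1 < e / 2 by apply: N_lt; exact: leq_maxl.
have ul_lt : rho (u n) l < e / 2 by apply: N'_lt; exact: leq_maxr.
apply: filterS (Fu n) => x un_x; rewrite /ball/= [e]splitr.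
apply: le_lt_trans (rho_triangle l (u n) x) _; rewrite (rhoC l) ltrD//.
exact: lt_trans un_x n_lt.
Qed.

Lemma ultra_bigcup (T : Type) (F : set_system T) (B : nat -> set T) n : UltraFilter F ->
  F (\bigcup_(i < n) B i) -> exists2 i, (i < n)%N & F (B i).
Proof.
move=> FU; elim: n => [|n IHn].
  by rewrite bigcup_mkord big_ord0 => /filter_ex[].
rewrite bigcup_mkord big_ord_recr /= -bigcup_mkord => FBn1.
have [FBn|FnBn] := in_ultra_setVsetC (B n) FU; first by exists n.
have [|i i_n FBi] := IHn; last by exists i => //; exact: leqW.
by apply: filterS (filterI FBn1 FnBn) => x [[]].
Qed.

Lemma compact_totally_bounded (A : set M) : closed A ->
  (forall e, 0 < e -> exists (c : nat -> X) n, A `<=` \bigcup_(i < n) ball (c i : M) e) ->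
  compact A.
Proof.
move=> cA coverA; rewrite compact_ultra => F FU FA.
have /cvg_ex[l Fl] : cvg F.
  apply: rho_complete_cvg => e /coverA[c [n Acover]].
  by have [i _ Fi] := ultra_bigcup FU (filterS Acover FA); exists (c i).
exists l; split=> //; rewrite closedE in cA; apply: cA => notAl.
by have [x []] := filter_ex (filterI (Fl _ notAl) FA).
Qed.

Variable P : probability (Borel rho) R.

Definition closed_regular (A : set M) := forall e : R, 0 < e -> exists F U : set M,
  [/\ closed F, open U, F `<=` A, A `<=` U & (P (U `\` F) <= e%:E)%E].

Lemma closed_regular_open (U : set M) : open U -> closed_regular U.
Proof.
move=> oU e e0; pose F n : set M := [set x | forall y, rho x y < n.+1%:R^-1 -> U y].
have cF n : closed (F n) by exact: closed_deep_interior.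
have [||||n PUF] := @probability_nonincreasing_small _ _ _ P (fun n => U `\` F n) e.
- move=> n; apply: measurableD; first exact: measurable_rho_open.
  exact: measurable_rho_closed.
- apply/nonincreasing_seqP => n; apply/subsetPset => x [Ux notF]; split=> // Fx.
  apply: notF => y xy; apply: Fx; apply: lt_le_trans xy _.
  by rewrite lef_pV2 ?posrE// ler_nat.
- rewrite -subset0 => x UFx; have [Ux _] := UFx 0%N I.
  move: oU; rewrite -rho_openE => /(_ x Ux)[r r0 rU].
  have [k _ k_lt] := near_infty_natSinv_lt (PosNum r0).
  have [_ []] := UFx k I => y xy; apply: rU; apply: lt_trans xy _.
  exact: k_lt (leqnn k).
- exact: e0.
by exists (F n), U; split=> // x; apply; rewrite rhoxx invr_gt0.
Qed.

Lemma closed_regularC A : closed_regular A -> closed_regular (~` A).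
Proof.
move=> rA e /rA[F [U [cF oU FA AU PUF]]]; exists (~` U), (~` F).
split; [exact: open_closedC|exact: closed_openC|exact: subsetC|exact: subsetC|].
by rewrite setDE setCK setIC -setDE.
Qed.

Lemma closed_regular_bigcup (A : nat -> set M) : (forall n, closed_regular (A n)) ->
  closed_regular (\bigcup_n A n).
Proof.
move=> rA e e0; have e20 : 0 < e / 2 by rewrite divr_gt0.
have approx n : exists FU : set M * set M, [/\ closed FU.1, open FU.2,
    FU.1 `<=` A n, A n `<=` FU.2 & (P (FU.2 `\` FU.1) <= ((e / 2) / (2 ^ n.+1)%:R)%:E)%E].
  have [|F [U FU]] := rA n ((e / 2) / (2 ^ n.+1)%:R); last by exists (F, U).
  by rewrite divr_gt0// ltr0n expn_gt0.
have {approx}[FU FUP] := choice approx.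
pose F n := (FU n).1; pose U n := (FU n).2.
have cF n : closed (F n) by case: (FUP n).
have oU n : open (U n) by case: (FUP n).
have mF n : measurable (F n : set (Borel rho)) by exact: measurable_rho_closed.
have mU n : measurable (U n : set (Borel rho)) by exact: measurable_rho_open.
have mUF : measurable (\bigcup_i (U i `\` F i) : set (Borel rho)).
  by apply: bigcup_measurable => i _; exact: measurableD.
have [n P_tail] := probability_nonincreasing_small P (fun n => measurable_bigcup_tail n mF)
  (@nonincreasing_bigcup_tail _ F) (bigcap_bigcup_tail F) e20.
exists (\bigcup_(i < n) F i), (\bigcup_i U i); split.
- by apply: closed_bigcup => //; exact: finite_II.
- by apply: bigcup_open => i _; exact: oU.
- by move=> x [i _ Fi]; exists i => //; have [_ _ + _ _] := FUP i; exact.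
- by move=> x [i _ Ai]; exists i => //; have [_ _ _ + _] := FUP i; exact.
apply: (@probabilityU_le _ (Borel rho) _ P _ (\bigcup_i (U i `\` F i)) (bigcup_tail F n)) => //.
- by apply: measurableD; exact: bigcup_measurable.
- exact: measurable_bigcup_tail.
- move=> x [[i _ Ui] notFn]; have [Fi|notFi] := pselect (F i x).
    by right; split=> //; exists i.
  by left; exists i.
- apply: probability_bigcup_le => [|i|i]; [exact: ltW|exact: measurableD|by case: (FUP i)].
Qed.

Lemma closed_regular_measurable (A : set (Borel rho)) : measurable A -> closed_regular A.
Proof.
apply: (@smallest_sub _ _ _ closed_regular); last by rewrite rho_openE; exact: closed_regular_open.
split; first exact/closed_regular_open/open0.
- by move=> B /closed_regularC; rewrite setTD.
- exact: closed_regular_bigcup.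
Qed.

Hypothesis rhoS : rho_separable rho.

Lemma dense_sequence : exists D : nat -> X, forall x (e : R), 0 < e ->
  exists i, rho (D i) x < e.
Proof.
have [D [cD dD]] := rhoS; have [y0 Dy0 _] := dD point 1 ltr01.
have /pfcard_geP[D0|[g]] := cD; first by rewrite D0 in Dy0.
by exists g => x e /(dD x)[y /('surj_g)[n _ <-] xgn]; exists n; rewrite rhoC.
Qed.

Lemma probability_tight (e : R) : 0 < e -> exists2 C : set M, compact C & (P (~` C) <= e%:E)%E.
Proof.
move=> e0; have [D dD] := dense_sequence.
pose B m i : set M := [set x | rho (D i) x <= m.+1%:R^-1].
have cB m n : closed (\bigcup_(i < n) B m i).
  by apply: closed_bigcup => [|i _]; [exact: finite_II|exact: closed_rho_ball].
have mB m i : measurable (B m i : set (Borel rho)).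
  by apply: measurable_rho_closed; exact: closed_rho_ball.
have coverB m : \bigcup_i B m i = setT.
  rewrite -subTset => x _; have [|i Dix] := dD x m.+1%:R^-1; first by rewrite invr_gt0.
  by exists i => //; exact: ltW.
have finite_cover m : exists n, (P (~` \bigcup_(i < n) B m i) <= (e / (2 ^ m.+1)%:R)%:E)%E.
  have em0 : 0 < e / (2 ^ m.+1)%:R by rewrite divr_gt0// ltr0n expn_gt0.
  have [n] := probability_nonincreasing_small P (fun n => measurable_bigcup_tail n (mB m))
    (@nonincreasing_bigcup_tail _ (B m)) (bigcap_bigcup_tail (B m)) em0.
  by exists n; rewrite -setTD -(coverB m).
have [N PN] := choice finite_cover.
have mBN m : measurable (~` (\bigcup_(i < N m) B m i) : set (Borel rho)).
  by apply/measurableC/bigcup_measurable.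
exists (\bigcap_m \bigcup_(i < N m) B m i); last first.
  by rewrite setC_bigcap; apply: probability_bigcup_le => //; exact: ltW.
apply: compact_totally_bounded => [|r r0]; first exact: closed_bigI.
have [m _ m_lt] := near_infty_natSinv_lt (PosNum r0).
exists D, (N m) => x /(_ m I)[i iN Bi]; exists i => //.
exact: le_lt_trans Bi (m_lt m (leqnn m)).
Qed.

Lemma compact_inner_regular (A : set (Borel rho)) (e : R) : measurable A -> 0 < e ->
  exists C : set M, [/\ compact C, C `<=` A & (P (A `\` C) <= e%:E)%E].
Proof.
move=> mA e0; have e20 : 0 < e / 2 by rewrite divr_gt0.
have [F [U [cF oU FA AU PUF]]] := closed_regular_measurable mA e20.
have [C cC PC] := probability_tight e20.
have mF := measurable_rho_closed cF; have mC := measurable_rho_compact cC.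
have mU := measurable_rho_open oU.
exists (C `&` F); split; [exact: compact_closedI|by move=> x [_ /FA]|].
apply: (probabilityU_le _ _ _ _ PUF PC) => //.
- by apply: measurableD => //; exact: measurableI.
- exact: measurableD.
- exact: measurableC.
- move=> x [Ax notCF]; have [Cx|notCx] := pselect (C x); last by right.
  by left; split=> [|Fx]; [exact: AU|exact: notCF].
Qed.

End MetricSpace.

(** * Ergodic components *)

Section ContinuousContent.
Context {d : measure_display} {X : algebraOfSetsType d} {R : realType}.
Variable mu : {content set X -> \bar R}.

Lemma content_sigma_additive : (mu setT < +oo)%E ->
  (forall F : (set X)^nat, (forall n, measurable (F n)) -> nonincreasing_seq F ->
    \bigcap_n F n = set0 -> forall e : R, 0 < e -> exists n, (mu (F n) <= e%:E)%E) ->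
  semi_sigma_additive mu.
Proof.
move=> muT mu_vanish F mF tF mUF.
have muf A : measurable A -> mu A \is a fin_num.
  move=> mA; rewrite ge0_fin_numE//; apply: le_lt_trans muT.
  by apply: le_measure; rewrite ?inE//.
have mUn n : measurable (\bigcup_(i < n) F i) by rewrite bigcup_mkord; exact: bigsetU_measurable.
have mtail n : measurable (bigcup_tail F n) by exact: measurableD.
have muE n : mu (\bigcup_i F i) = (\sum_(0 <= i < n) mu (F i) + mu (bigcup_tail F n))%E.
  rewrite big_mkord -measure_bigsetU//.
  rewrite -bigcup_mkord -measureU//; last exact: setDIK.
  by rewrite setDUK// => x [i _ Fi]; exists i.
have sum_fin n : (\sum_(0 <= i < n) mu (F i))%E \is a fin_num.
  by apply/sum_fin_numP => i _ _; exact: muf.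
rewrite -[X in _ --> X]fineK ?muf//; apply/fine_cvgP; split; first exact: nearW.
apply/cvgrPdist_le => e e0; have [N tailN] := mu_vanish _ mtail
  (@nonincreasing_bigcup_tail _ F) (bigcap_bigcup_tail F) e e0.
exists N => // n Nn; rewrite /= (muE n) fineD ?muf//= addrC addKr ger0_norm ?fine_ge0//.
rewrite -lee_fin fineK ?muf//; apply: le_trans tailN.
by apply: le_measure; rewrite ?inE//; exact/subsetPset/nonincreasing_bigcup_tail.
Qed.

End ContinuousContent.

Section CompactIntersection.
Variable X : ptopologicalType.

Lemma compact_bigcap_eq0 (C : (set X)^nat) : hausdorff_space X -> (forall n, compact (C n)) ->
  \bigcap_n C n = set0 -> exists n, \bigcap_(i < n) C i = set0.
Proof.
move=> hX cC C0; apply: contrapT => /forallNP C_neq0.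
have : \bigcap_n (C 0%N `&` C n) !=set0.
  have := cC 0%N; rewrite compact_In0 => /(_ nat setT (fun n => C 0%N `&` C n)); apply.
    by exists C => // i _; exact: compact_closed hX (cC i).
  move=> D _; have /eqP/set0P[x Cx] := C_neq0 (\max_(i <- finmap.enum_fset D) i).+1.
  exists x => i /= iD; split; first exact: Cx.
  by apply: Cx; rewrite /= ltnS; exact: leq_bigmax_seq.
by case=> x Cx; suff : (\bigcap_n C n) x; [rewrite C0|move=> n _; have [] := Cx n I].
Qed.

End CompactIntersection.

(* A point can be typical for countably many sets at once: those named by terms over a countable
   family of atoms form an algebra invariant under preimages. *)
Inductive set_term := Atom of nat | Neg of set_term | And of set_term & set_term
  | Pre of set_term.

Fixpoint set_term_encode (s : set_term) : GenTree.tree nat :=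
  match s with
  | Atom n => GenTree.Leaf n
  | Neg s => GenTree.Node 0 [:: set_term_encode s]
  | And s1 s2 => GenTree.Node 1 [:: set_term_encode s1; set_term_encode s2]
  | Pre s => GenTree.Node 2 [:: set_term_encode s]
  end.

Fixpoint set_term_decode (u : GenTree.tree nat) : set_term :=
  match u with
  | GenTree.Leaf n => Atom n
  | GenTree.Node 0 [:: s] => Neg (set_term_decode s)
  | GenTree.Node 1 [:: s1; s2] => And (set_term_decode s1) (set_term_decode s2)
  | GenTree.Node 2 [:: s] => Pre (set_term_decode s)
  | _ => Atom 0
  end.

Lemma set_term_encodeK : cancel set_term_encode set_term_decode.
Proof. by elim=> //= [s ->|s1 -> s2 ->|s ->]. Qed.

HB.instance Definition _ := Countable.copy set_term (can_type set_term_encodeK).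

Definition falsum := And (Atom 0) (Neg (Atom 0)).
Definition verum := Neg falsum.

Fixpoint eval_term (X : Type) (T : X -> X) (b : nat -> set X) (s : set_term) : set X :=
  match s with
  | Atom n => b n
  | Neg s => ~` eval_term T b s
  | And s1 s2 => eval_term T b s1 `&` eval_term T b s2
  | Pre s => T @^-1` eval_term T b s
  end.

Definition term_algebra (X : pointedType) (T : X -> X) (b : nat -> set X) : Type := X.

Section TermAlgebra.
Variables (X : pointedType) (T : X -> X) (b : nat -> set X).

Lemma eval_falsum : eval_term T b falsum = set0.
Proof. by rewrite /= setICr. Qed.

Lemma eval_verum : eval_term T b verum = setT.
Proof. by rewrite /= setICr setC0. Qed.

Let term_algebra0 : range (eval_term T b) set0.
Proof. by exists falsum => //; exact: eval_falsum. Qed.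

Let term_algebraU : setU_closed (range (eval_term T b)).
Proof.
move=> _ _ [s _ <-] [s' _ <-]; exists (Neg (And (Neg s) (Neg s'))) => //=.
by rewrite setCI !setCK.
Qed.

Let term_algebraC : setC_closed (range (eval_term T b)).
Proof. by move=> _ [s _ <-]; exists (Neg s). Qed.

HB.instance Definition _ := Pointed.on (term_algebra T b).
HB.instance Definition _ := isAlgebraOfSets.Build default_measure_display
  (term_algebra T b) term_algebra0 term_algebraU term_algebraC.

End TermAlgebra.

Section BorelMeasurability.
Variables (R : realType) (X : pointedType) (rho : X -> X -> R).

Lemma measurable_rho_continuous (f : X -> X) : rho_continuous rho f ->
  measurable_fun setT (f : Borel rho -> Borel rho).
Proof.
move=> cf; apply: (@measurability _ _ (Borel rho) (Borel rho) _ _ (rho_open rho)) => //.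
move=> _ [U oU <-]; apply: sub_sigma_algebra; rewrite setTI => x /= /oU[e e0 eU].
by have [d d0 df] := cf x e e0; exists d => // y /df /eU.
Qed.

Lemma rho_continuous_real_bounded_mfun (f : X -> R) : rho_continuous_real rho f ->
  bounded_fun f -> bounded_mfun (f : Borel rho -> R).
Proof.
move=> cf bf; split=> //; apply: (measurability _ (RGenOInfty.measurableE R)) => //.
move=> _ [_ [r ->] <-]; apply: sub_sigma_algebra; rewrite setTI => x /=.
rewrite in_itv /= andbT => rx; have [|d d0 df] := cf x (f x - r); first by rewrite subr_gt0.
by exists d => // y /df /=; rewrite in_itv /= andbT ltr_norml => /andP[]; lra.
Qed.

Lemma rho_continuous_iter (f : X -> X) j : rho_continuous rho f -> rho_continuous rho (iter j f).
Proof.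
move=> cf; elim: j => [|j cfj] x e e0; first by exists e.
have [d d0 df] := cf (iter j f x) e e0; have [d' d'0 df'] := cfj x d d0.
by exists d' => // y /df' /df.
Qed.

End BorelMeasurability.

Lemma sum_halves_le (R : realFieldType) (e : R) n : 0 <= e ->
  \sum_(i < n) e / (2 ^ i.+1)%:R <= e.
Proof.
move=> e0; suff -> : \sum_(i < n) e / (2 ^ i.+1)%:R = e - e / (2 ^ n)%:R.
  by rewrite lerBlDr lerDl divr_ge0.
elim: n => [|n IHn]; first by rewrite big_ord0 divr1 subrr.
have pow_neq0 : (2 ^ n)%:R != 0 :> R by rewrite pnatr_eq0 expn_eq0.
by rewrite big_ord_recr /= IHn expnS natrM; field.
Qed.

Section TightPoints.
Variables (R : realType) (X : pointedType) (rho : X -> X -> R) (T : X -> X).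
Hypothesis rhoM : is_metric rho.

Local Notation M := (metric_space rhoM).
Local Notation limsup := (birkhoff_limsup T).

Definition tight_at (x : X) (A : set X) := forall e : R, 0 < e -> exists C : set M,
  [/\ compact C, C `<=` A & limsup (\1_(A `\` C)) x < e].

Lemma tight_at_vanish x (A : (set X)^nat) : (forall n, tight_at x (A n)) -> nonincreasing_seq A ->
  \bigcap_n A n = set0 -> forall e : R, 0 < e -> exists n, limsup (\1_(A n)) x <= e.
Proof.
move=> tA ndA A0 e e0.
have approx n : exists C : set M, [/\ compact C, C `<=` A n &
    limsup (\1_(A n `\` C)) x < e / (2 ^ n.+1)%:R].
  by apply: tA; rewrite divr_gt0// ltr0n expn_gt0.
have {approx}[C CP] := choice approx.
have cC n : compact (C n) by case: (CP n).
have C0 : \bigcap_n C n = set0.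
  by rewrite -subset0 -A0 => y Cy n _; have [_ CA _] := CP n; exact/CA/Cy.
have [n Cn0] := compact_bigcap_eq0 (@metric_hausdorff _ M) cC C0.
exists n; apply: (@le_trans _ _ (limsup (\1_(\bigcup_(i < n) (A i `\` C i))) x)).
  apply: birkhoff_limsup_indic_le => y Any.
  have /existsNP[i /not_implyP[/= i_n notCi]] : ~ (\bigcap_(i < n) C i) y by rewrite Cn0.
  by exists i => //; split=> //; have /subsetPset := ndA _ _ (ltnW i_n); apply.
apply: le_trans (birkhoff_limsup_bigcup_le _ _ _ _) _.
by apply: le_trans (sum_halves_le n (ltW e0)); apply: ler_sum => i _; case: (CP i) => _ _ /ltW.
Qed.

Hypotheses (rhoX : rho_complete rho) (rhoS : rho_separable rho).
Hypothesis cT : rho_continuous rho T.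
Variable mu : probability (Borel rho) R.
Hypothesis muT : invariant_prob rho T mu.

Lemma ae_tight_at (A : set (Borel rho)) : measurable A -> {ae mu, forall x, tight_at x A}.
Proof.
move=> mA; have mT := measurable_rho_continuous cT.
have approx m : exists C : set M,
    [/\ compact C, C `<=` A & (mu (A `\` C) <= (m.+1%:R^-1)%:E)%E].
  by apply: compact_inner_regular => //; rewrite invr_gt0.
have {approx}[C CP] := choice approx.
have mAC m : measurable (A `\` C m : set (Borel rho)).
  by apply: measurableD => //; apply: measurable_rho_compact; case: (CP m).
have bAC m := bounded_mfun_indic (R := R) (mAC m).
have : {ae mu, forall x (e : R), 0 < e -> exists m, limsup (\1_(A `\` C m)) x < e}.
  apply: (@ae_inf_eq0 _ (Borel rho) R mu (fun m => limsup (\1_(A `\` C m)))) => [m|m x|e e0].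
    exact: bounded_mfun_birkhoff_limsup.
    by apply: birkhoff_limsup_ge0 => [|y]; [case: (bAC m)|rewrite indicE].
  have [m _ m_lt] := near_infty_natSinv_lt (PosNum e0); exists m.
  have [-> _] := birkhoff mT muT (bAC m).
  rewrite Rintegral_indic// -lee_fin fineK ?fin_num_measure//.
  have [_ _ /le_trans] := CP m; apply; rewrite lee_fin ltW//; exact: m_lt (leqnn m).
apply: (@filterS _ _ (ae_filter_ringOfSetsType mu)) => x small e /small[m lim_lt].
by exists (C m); case: (CP m).
Qed.

End TightPoints.

Section ComponentMeasure.
Variables (R : realType) (X : pointedType) (rho : X -> X -> R) (T : X -> X).
Hypothesis rhoM : is_metric rho.
Variable b : nat -> set X.
Hypothesis mb : forall n, measurable (b n : set (Borel rho)).
Hypothesis gen_b : rho_open rho `<=` <<s range b >>.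
Hypothesis cT : rho_continuous rho T.

Local Notation avg := (birkhoff_avg T).
Local Notation limsup := (birkhoff_limsup T).
Local Notation ev := (eval_term T b).
Local Notation alg := (term_algebra T b).

Lemma measurable_ev s : measurable (ev s : set (Borel rho)).
Proof.
elim: s => [n|s ms|s1 ms1 s2 ms2|s ms] /=; [exact: mb|exact: measurableC|exact: measurableI|].
by rewrite -[X in measurable X]setTI; exact: (measurable_rho_continuous cT measurableT ms).
Qed.

Lemma sigma_term_algebra : measurable = <<s range ev >> :> set (set (Borel rho)).
Proof.
apply/seteqP; split; apply: smallest_sub; do ?exact: smallest_sigma_algebra.
  apply: subset_trans gen_b _; apply: sub_smallest2r; first exact: smallest_sigma_algebra.
  by move=> _ [n _ <-]; exists (Atom n).
by move=> _ [s _ <-]; exact: measurable_ev.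
Qed.

Definition typical_point x : Prop := forall s,
  [/\ avg (\1_(ev s)) x @ \oo --> (limsup (\1_(ev s)) x : R), tight_at T rhoM x (ev s) &
    mean_square_cvg_at T (\1_(ev s) : X -> R) x].

Variable x : X.
Hypothesis typical_x : typical_point x.

Definition visit_freq (A : set alg) : \bar R := (limsup (\1_A) x)%:E.

Let visit_freq0 : visit_freq set0 = 0%E.
Proof. by rewrite /visit_freq birkhoff_limsup_indic0. Qed.

Let visit_freq_ge0 A : (0 <= visit_freq A)%E.
Proof.
by rewrite lee_fin; apply: birkhoff_limsup_ge0 => [|y]; [exact: bounded_fun_indic|rewrite indicE].
Qed.

Let visit_freqU : additive2 visit_freq.
Proof.
move=> _ _ [s _ <-] [s' _ <-] disj; rewrite /visit_freq -EFinD; congr EFin.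
apply: birkhoff_limsupE.
have -> : \1_(ev s `|` ev s') = \1_(ev s) \+ \1_(ev s') :> (X -> R).
  apply/funext => y; rewrite /= !indicE in_setU.
  have [/set_mem sy|_] := boolP (y \in ev s); last by rewrite add0r.
  by rewrite memNset ?addr0// => s'y; have : set0 y by rewrite -disj.
by rewrite birkhoff_avgD; apply: cvgD; [case: (typical_x s)|case: (typical_x s')].
Qed.

HB.instance Definition _ := isContent.Build _ alg R visit_freq visit_freq_ge0
  (proj2 (additive2P visit_freq0) visit_freqU).

Let visit_freq_sigma_additive : semi_sigma_additive visit_freq.
Proof.
apply: content_sigma_additive => [|F mF ndF F0 e e0]; first by rewrite ltry.
have [n lim_le] : exists n, limsup (\1_(F n)) x <= e; last by exists n; rewrite lee_fin.
by apply: (tight_at_vanish (rhoM := rhoM)) e0 => // n; have [s _ <-] := mF n; case: (typical_x s).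
Qed.

HB.instance Definition _ := Content_isMeasure.Build _ alg R visit_freq visit_freq_sigma_additive.

Definition component : set (Borel rho) -> \bar R := measure_extension visit_freq.

Let component_ev s : component (ev s) = (limsup (\1_(ev s)) x)%:E.
Proof. by rewrite /component /measure_extension measurable_mu_extE//; exists s. Qed.

Let component0 : component set0 = 0%E.
Proof. exact: measure0. Qed.

Let component_ge0 A : (0 <= component A)%E.
Proof. exact: measure_ge0. Qed.

Let component_sigma_additive : semi_sigma_additive component.
Proof.
have mE A : measurable (A : set (Borel rho)) -> <<s range ev >> A by rewrite sigma_term_algebra.
move=> F mF tF /mE mUF.
by apply: (@measure_semi_sigma_additive _ _ _ (measure_extension visit_freq)) => // i; exact: mE.
Qed.

HB.instance Definition _ := isMeasure.Build _ (Borel rho) R component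
  component0 component_ge0 component_sigma_additive.

Let componentT : component setT = 1%E.
Proof.
rewrite -(eval_verum T b) component_ev eval_verum indicT.
by rewrite (birkhoff_limsupE (birkhoff_avg_cst_cvg T x)).
Qed.

HB.instance Definition _ := Measure_isProbability.Build _ _ _ component componentT.

Lemma component_probability : exists nu : probability (Borel rho) R,
  forall s, nu (ev s) = (limsup (\1_(ev s)) x)%:E.
Proof. by exists component; exact: component_ev. Qed.

End ComponentMeasure.

Section TermMeasures.
Variables (R : realType) (X : pointedType) (rho : X -> X -> R) (T : X -> X).
Variable b : nat -> set X.
Hypothesis mb : forall n, measurable (b n : set (Borel rho)).
Hypothesis gen_b : rho_open rho `<=` <<s range b >>.
Hypothesis cT : rho_continuous rho T.

Local Notation ev := (eval_term T b).

Lemma eq_measure_terms (m1 m2 : {measure set (Borel rho) -> \bar R}) :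
  (m1 setT < +oo)%E -> (forall s, m1 (ev s) = m2 (ev s)) ->
  forall A : set (Borel rho), measurable A -> m1 A = m2 A.
Proof.
move=> m1T m12 A mA.
apply: (@measure_unique _ R (Borel rho) (range ev) (fun=> setT) _ _ _ _ m1 m2 _ _ A mA) => //.
- exact: sigma_term_algebra.
- by move=> _ _ [s _ <-] [s' _ <-]; exists (And s s').
- by move=> _; exists verum; rewrite ?eval_verum.
- by rewrite bigcup_const//; exists 0%N.
- by move=> _ [s _ <-].
Qed.

Inductive term_simple : (X -> R) -> Prop :=
| term_simple_indic s : term_simple (\1_(ev s))
| term_simpleD f g : term_simple f -> term_simple g -> term_simple (f \+ g)
| term_simpleZ c f : term_simple f -> term_simple (fun y => c * f y).

Lemma term_simple_cst (c : R) : term_simple (cst c).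
Proof.
have := term_simpleZ c (term_simple_indic verum); congr term_simple.
by apply/funext => y; rewrite eval_verum indicT mulr1.
Qed.

Lemma term_simpleM f g : term_simple f -> term_simple g -> term_simple (f \* g).
Proof.
move=> sf sg; elim: sf => [s|f1 f2 _ sf1g _ sf2g|c f1 _ sf1g].
- elim: sg => [s'|g1 g2 _ sg1 _ sg2|c g1 _ sg1].
  + by have := term_simple_indic (And s s'); rewrite /= indicI.
  + have := term_simpleD sg1 sg2; congr term_simple.
    by apply/funext => y /=; rewrite mulrDr.
  + have := term_simpleZ c sg1; congr term_simple.
    by apply/funext => y /=; rewrite mulrCA.
- have := term_simpleD sf1g sf2g; congr term_simple.
  by apply/funext => y /=; rewrite mulrDl.
- have := term_simpleZ c sf1g; congr term_simple.
  by apply/funext => y /=; rewrite mulrA.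
Qed.

Lemma term_simple_iter f j : term_simple f -> term_simple (f \o iter j T).
Proof.
have term_simple_comp g : term_simple g -> term_simple (g \o T).
  elim=> [s|g1 g2 _ sg1 _ sg2|c g1 _ sg1].
  - exact: term_simple_indic (Pre s).
  - exact: term_simpleD sg1 sg2.
  - exact: term_simpleZ sg1.
move=> sf; elim: j => // j /term_simple_comp; congr term_simple.
by apply/funext => y; rewrite /= -iterSr.
Qed.

Lemma term_simple_birkhoff_avg n f : term_simple f -> term_simple (birkhoff_avg T f ^~ n).
Proof.
move=> sf; apply: term_simpleZ; elim: n => [|n sn].
  have := term_simple_cst 0; congr term_simple.
  by apply/funext => y; rewrite birkhoff_sum0.
have := term_simpleD sn (term_simple_iter n sf); congr term_simple.
by apply/funext => y /=; rewrite birkhoff_sumSr.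
Qed.

Lemma term_simple_bounded_mfun f : term_simple f -> bounded_mfun (f : Borel rho -> R).
Proof.
elim=> [s|f1 f2 _ bf1 _ bf2|c f1 _ bf1]; last 2 first.
- exact: bounded_mfunD.
- exact: bounded_mfunZ.
by apply: bounded_mfun_indic; exact: measurable_ev.
Qed.

End TermMeasures.

Section ErgodicComponent.
Variables (R : realType) (X : pointedType) (rho : X -> X -> R) (T : X -> X).
Hypothesis rhoM : is_metric rho.
Variable b : nat -> set X.
Hypothesis mb : forall n, measurable (b n : set (Borel rho)).
Hypothesis gen_b : rho_open rho `<=` <<s range b >>.
Hypothesis cT : rho_continuous rho T.

Local Notation avg := (birkhoff_avg T).
Local Notation limsup := (birkhoff_limsup T).
Local Notation ev := (eval_term T b).

Variable x : X.
Hypothesis typical_x : typical_point T rhoM b x.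
Variable nu : probability (Borel rho) R.
Hypothesis nuE : forall s, nu (ev s) = (limsup (\1_(ev s)) x)%:E.

Let mT : measurable_fun setT (T : Borel rho -> Borel rho) := measurable_rho_continuous cT.
Let mev s : measurable (ev s : set (Borel rho)) := measurable_ev mb cT s.
Let bev s : bounded_mfun (\1_(ev s) : Borel rho -> R) := bounded_mfun_indic (mev s).

Lemma component_invariant : invariant_prob rho T nu.
Proof.
move=> A mA; have -> : nu (T @^-1` A) = pushforward nu (T : Borel rho -> Borel rho) A by [].
apply: (eq_measure_terms mb gen_b cT) mA => [|s]; rewrite /= /pushforward.
  by rewrite preimage_setT -ge0_fin_numE ?fin_num_measure.
rewrite (nuE (Pre s)) nuE -(birkhoff_limsup_comp T x (proj2 (bev s))); congr (limn_sup _)%:E.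
apply/funext => n; rewrite /birkhoff_avg /birkhoff_sum; congr (_ * _).
by apply: eq_bigr => j _; rewrite -iterSr !indicE; congr ((_ : bool)%:R).
Qed.

Lemma term_simple_avg_cvg f : term_simple T b f -> avg f x @ \oo --> \int[nu]_y f y.
Proof.
elim=> [s|f1 f2 sf1 f1_cvg sf2 f2_cvg|c f1 sf1 f1_cvg].
- by rewrite Rintegral_indic// nuE; case: (typical_x s).
- have [bf1 bf2] := (term_simple_bounded_mfun mb cT sf1, term_simple_bounded_mfun mb cT sf2).
  by rewrite bounded_RintegralD// birkhoff_avgD; exact: cvgD.
- rewrite bounded_RintegralZ; last exact: term_simple_bounded_mfun sf1.
  by rewrite birkhoff_avgZ; apply: cvgM => //; exact: cvg_cst.
Qed.

Lemma component_second_moment_small s (e : R) : 0 < e ->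
  exists n, \int[nu]_y (avg (\1_(ev s)) y n.+1 - fine (nu (ev s))) ^+ 2 < e.
Proof.
have [_ _ msq_cvg] := typical_x s => /msq_cvg[n lim_lt].
exists n; rewrite nuE /=; set c := limsup _ x.
have ss : term_simple T b (fun y => avg (\1_(ev s)) y n.+1 - c).
  apply: (@term_simpleD _ _ _ _ _ (cst (- c))); last exact: term_simple_cst.
  exact/term_simple_birkhoff_avg/term_simple_indic.
rewrite -(birkhoff_limsupE (term_simple_avg_cvg (term_simpleM ss ss))).
apply: le_lt_trans lim_lt; rewrite le_eqVlt; apply/orP; left; apply/eqP; congr limn_sup.
apply/funext => N; rewrite /birkhoff_avg /birkhoff_sum; congr (_ * _); apply: eq_bigr => j _.
by rewrite (birkhoff_limsup_iter _ _ _ (proj2 (bev s))).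
Qed.

(* By invariance [nu (A `&` ev s)] is the integral over [A] of the time averages of [ev s],
   which are close to the constant [nu (ev s)] in L^2. *)
Lemma component_independent (A : set (Borel rho)) s : measurable A -> T @^-1` A = A ->
  fine (nu (A `&` ev s)) = fine (nu A) * fine (nu (ev s)).
Proof.
move=> mA TA; have bA := bounded_mfun_indic (R := R) mA.
have AT : \1_A \o T = \1_A :> (X -> R).
  by apply/funext => y; rewrite /= !indicE -[in RHS]TA; congr ((_ : bool)%:R);
    apply/idP/idP; rewrite !inE.
set c := fine (nu (ev s)); pose dev n y := avg (\1_(ev s)) y n.+1 - c.
have bavg n := bounded_mfun_birkhoff_avg mT n.+1 (bev s).
have bdev n : bounded_mfun (dev n : Borel rho -> R).
  by apply: bounded_mfunB => //; exact: bounded_mfun_cst.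
have diffE n : fine (nu (A `&` ev s)) - fine (nu A) * c = \int[nu]_y (\1_A y * dev n y).
  have -> : fine (nu (A `&` ev s)) = \int[nu]_y (\1_A y * \1_(ev s) y).
    rewrite -Rintegral_indic; last exact: measurableI.
    by apply: eq_Rintegral => y _; rewrite indicI.
  rewrite -(Rintegral_mul_birkhoff_avg mT component_invariant bA AT (bev s) (ltn0Sn n)).
  rewrite -(Rintegral_indic nu mA) mulrC -bounded_RintegralZ// -bounded_RintegralB.
  - by apply: eq_Rintegral => y _; rewrite /dev mulrBr [c * _]mulrC.
  - exact: bounded_mfunM.
  - exact: bounded_mfunZ.
apply/eqP; rewrite -subr_eq0 -normr_eq0 eq_le normr_ge0 andbT; apply/ler_addgt0Pr => e e0.
have e20 : 0 < e / 2 by rewrite divr_gt0.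
have [n dev_small] := component_second_moment_small s (mulr_gt0 e20 e20).
rewrite (diffE n) add0r [leRHS]splitr.
apply: le_trans (Rintegral_le_second_moment nu bA (normr_indic_le1 A) (bdev n) e20) _.
by rewrite lerD2l ler_pdivrMl// ltW.
Qed.

Lemma component_ergodic : ergodic rho T nu.
Proof.
split; first exact: component_invariant.
move=> A mA TA; have nuA : nu A \is a fin_num by exact: fin_num_measure.
have nuA0 : 0 <= fine (nu A) by rewrite fine_ge0.
have /= : mrestr nu mA A = mscale (NngNum nuA0) nu A.
  apply: (eq_measure_terms mb gen_b cT _ _ mA) => [|s] /=.
    by rewrite /mrestr setTI -ge0_fin_numE.
  have mAs : measurable (A `&` ev s) by exact: measurableI.
  rewrite /mrestr /mscale /= setIC -(fineK (fin_num_measure nu _ mAs)).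
  by rewrite -(fineK (fin_num_measure nu _ (mev s))) -EFinM component_independent.
rewrite /mrestr /mscale /= setIid -(fineK nuA) -EFinM => -[nuA_idem].
have /eqP : fine (nu A) * (fine (nu A) - 1) = 0 by rewrite mulrBr mulr1 -nuA_idem subrr.
by rewrite mulf_eq0 subr_eq0 => /orP[] /eqP ->; [left|right].
Qed.

End ErgodicComponent.

Section LevelSets.
Variables (R : realType) (X : Type).

Lemma sum_natr_le_truncn (a : R) n : 0 <= a <= n%:R ->
  (\sum_(i < n) (i.+1%:R <= a)%R)%N = Num.truncn a.
Proof.
move=> /andP[a0 an]; have /andP[truncn_le _] := truncn_itv a0.
have truncn_n : (Num.truncn a <= n)%N by rewrite -(ler_nat R) (le_trans truncn_le).
rewrite (eq_bigr (fun i : 'I_n => if (i < Num.truncn a)%N then 1%N else 0%N)) => [|i _].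
  by rewrite -big_mkcond /= -(big_ord_widen n (fun=> 1%N)) // sum1_card card_ord.
by rewrite -truncn_gt_nat; case: ltnP.
Qed.

Definition level_set (f : X -> R) n i : set X := [set y | i.+1%:R / n%:R <= f y].

Definition level_approx (f : X -> R) n y : R := n%:R^-1 * \sum_(i < n) \1_(level_set f n i) y.

Lemma level_approx_dist f n y : (0 < n)%N -> 0 <= f y <= 1 ->
  `|f y - level_approx f n y| <= n%:R^-1.
Proof.
move=> n0 /andP[fy0 fy1]; have nR0 : 0 < n%:R :> R by rewrite ltr0n.
have fyn : 0 <= f y * n%:R <= n%:R by rewrite mulr_ge0 ?ler_piMl// ltW.
have -> : level_approx f n y = n%:R^-1 * (Num.truncn (f y * n%:R))%:R.
  rewrite -(sum_natr_le_truncn fyn) natr_sum; congr (_ * _); apply: eq_bigr => i _.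
  rewrite indicE -ler_pdivrMr//; congr ((_ : bool) : nat)%:R.
  by apply/idP/idP; rewrite inE.
have /andP[trunc_le lt_trunc] := truncn_itv (proj1 (andP fyn)).
rewrite -(ler_pM2l nR0) mulfV ?gt_eqF// -[X in X * `|_|](gtr0_norm nR0) -normrM.
rewrite mulrBr mulVKf ?gt_eqF// mulrC ger0_norm ?subr_ge0//.
by move: lt_trunc; rewrite -natr1; lra.
Qed.

End LevelSets.

Section UniformApproximation.
Context {d : measure_display} {X : measurableType d} {R : realType}.
Variables (T : X -> X) (nu : probability X R).

Lemma birkhoff_avg_cvg_uniform (f : X -> R) (F : nat -> X -> R) x :
  bounded_mfun f -> (forall n, bounded_mfun (F n)) ->
  (forall n y, `|f y - F n y| <= n.+1%:R^-1) ->
  (forall n, birkhoff_avg T (F n) x @ \oo --> \int[nu]_y F n y) ->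
  birkhoff_avg T f x @ \oo --> \int[nu]_y f y.
Proof.
move=> bf bF fF F_cvg.
apply/cvgrPdist_lt => e e0; have e30 : 0 < e / 3 by rewrite divr_gt0.
have [k _ /(_ k (leqnn k)) /= k_lt] := near_infty_natSinv_lt (PosNum e30).
have int_dist : `|\int[nu]_y f y - \int[nu]_y F k y| <= k.+1%:R^-1.
  exact: bounded_Rintegral_dist_le.
have := F_cvg k => /cvgrPdist_lt/(_ _ e30); apply: filterS => n.
have avg_dist : `|birkhoff_avg T f x n - birkhoff_avg T (F k) x n| <= k.+1%:R^-1.
  have -> : birkhoff_avg T f x n - birkhoff_avg T (F k) x n = birkhoff_avg T (f \- F k) x n.
    by rewrite birkhoff_avgD birkhoff_avgN.
  by apply: normr_birkhoff_avg_le => y; exact: fF.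
move: avg_dist int_dist k_lt; move: (_ ^-1) => r.
rewrite !ler_norml !ltr_norml => /andP[? ?] /andP[? ?] ? /andP[? ?].
by apply/andP; split; lra.
Qed.

End UniformApproximation.

Section ErgodicComponents.
Variables (R : realType) (X : pointedType) (rho : X -> X -> R) (T : X -> X).
Hypotheses (rhoM : is_metric rho) (rhoX : rho_complete rho) (rhoS : rho_separable rho).

Local Notation avg := (birkhoff_avg T).
Local Notation limsup := (birkhoff_limsup T).

Lemma countable_open_basis : exists B : nat -> set X,
  (forall n, rho_open rho (B n)) /\
  forall U, rho_open rho U -> U = \bigcup_(n in [set n | B n `<=` U]) B n.
Proof.
have [D dD] := dense_sequence rhoM rhoS.
pose B n : set X := if unpickle n is Some (i, m) then [set y | rho (D i) y < m.+1%:R^-1] else set0.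
exists B; split=> [n|U oU].
  rewrite /B (rho_openE rhoM); case: unpickle => [[i m]|]; last exact: open0.
  exact: open_rho_ball.
apply/seteqP; split=> y; last by case=> n /= BU /BU.
move=> /oU[e e0 eU]; have e20 : 0 < e / 2 by rewrite divr_gt0.
have [m _ /(_ m (leqnn m)) /= m_lt] := near_infty_natSinv_lt (PosNum e20).
have [|i yDi] := dD y m.+1%:R^-1; first by rewrite invr_gt0.
exists (pickle (i, m)); rewrite /B /= pickleK//= => z Diz; apply: eU.
apply: le_lt_trans (rho_triangle rhoM y (D i) z) _; rewrite (rhoC rhoM y) [e]splitr.
by rewrite ltrD//; [exact: lt_trans yDi m_lt|exact: lt_trans Diz m_lt].
Qed.

Lemma generating_sequence (c : nat -> set X) : (forall n, measurable (c n : set (Borel rho))) ->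
  exists b : nat -> set X, [/\ forall n, measurable (b n : set (Borel rho)),
    rho_open rho `<=` <<s range b >> & forall n, range b (c n)].
Proof.
move=> mc; have [B [oB openE]] := countable_open_basis.
exists (fun n => if odd n then c n./2 else B n./2); split=> [n|U /openE ->|n].
- by case: ifP => _; [exact: mc|apply: sub_sigma_algebra; exact: oB].
- rewrite bigcup_mkcond; apply: sigma_algebra_bigcup => n; case: ifP => _.
    by apply: sub_sigma_algebra; exists n.*2; rewrite ?odd_double ?doubleK.
  exact: sigma_algebra0.
- by exists n.*2.+1 => //=; rewrite odd_double /= uphalf_double.
Qed.

Hypothesis cT : rho_continuous rho T.
Variable mu : probability (Borel rho) R.
Hypothesis muT : invariant_prob rho T mu.

Lemma ae_typical_point (b : nat -> set X) : (forall n, measurable (b n : set (Borel rho))) ->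
  {ae mu, forall x, typical_point T rhoM b x}.
Proof.
move=> mb; have mT := measurable_rho_continuous cT.
apply: ae_forall_countable => s; have ms := measurable_ev mb cT s.
have bs := bounded_mfun_indic (R := R) ms; have [_ ae_cvg] := birkhoff mT muT bs.
have ae_tight := ae_tight_at rhoM rhoX rhoS cT muT ms.
have ae_msq := ae_mean_square_cvg_at mT muT bs.
apply: (@filterS3 _ _ (ae_filter_ringOfSetsType mu) _ _ _ _ _ ae_cvg ae_tight ae_msq) => x.
by move=> cvg_x tight_x msq_x; split.
Qed.

Lemma ae_ergodic_component_sets (c : nat -> set X) :
  (forall n, measurable (c n : set (Borel rho))) ->
  {ae mu, forall x, exists2 nu : probability (Borel rho) R, ergodic rho T nu &
    forall n, avg (\1_(c n)) x @ \oo --> fine (nu (c n))}.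
Proof.
move=> mc; have [b [mb gen_b bc]] := generating_sequence mc.
apply: (@filterS _ _ (ae_filter_ringOfSetsType mu) _ _ _ (ae_typical_point mb)) => x typical_x.
have [nu nuE] := component_probability mb gen_b cT typical_x.
exists nu => [|n]; first exact: component_ergodic typical_x nu nuE.
have [m _ <-] := bc n; rewrite -[b m]/(eval_term T b (Atom m)) nuE.
by have [] := typical_x (Atom m).
Qed.

Lemma ae_ergodic_component_unit (f : X -> R) :
  measurable_fun setT (f : Borel rho -> R) -> (forall y, 0 <= f y <= 1) ->
  {ae mu, forall x, exists2 nu : probability (Borel rho) R, ergodic rho T nu &
    avg f x @ \oo --> \int[nu]_y f y}.
Proof.
move=> mf f01.
have mL n i : measurable (level_set f n i : set (Borel rho)).
  rewrite [level_set f n i](_ : _ = setT `&` f @^-1` `[i.+1%:R / n%:R, +oo[).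
    by apply: mf => //; exact: measurable_itv.
  by rewrite setTI; apply/seteqP; split=> y /=; rewrite /level_set/= in_itv /= andbT.
pose c n := if unpickle n is Some (k, i) then level_set f k i else set0.
have mc n : measurable (c n : set (Borel rho)) by rewrite /c; case: unpickle => [[k i]|].
apply: (@filterS _ _ (ae_filter_ringOfSetsType mu) _ _ _ (ae_ergodic_component_sets mc)).
move=> x [nu nu_erg cvg_c]; exists nu => //.
have bf : bounded_mfun (f : Borel rho -> R).
  split=> //; apply/bounded_fun_leP; exists 1 => y.
  by have /andP[fy0 fy1] := f01 y; rewrite ger0_norm.
have bL n i := bounded_mfun_indic (R := R) (mL n i).
have bF n : bounded_mfun (level_approx f n : Borel rho -> R).
  by apply: bounded_mfunZ; apply: bounded_mfun_sum => i; exact: bL.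
apply: (birkhoff_avg_cvg_uniform bf (fun n => bF n.+1)) => [n y|n].
  exact: level_approx_dist.
rewrite bounded_RintegralZ ?bounded_Rintegral_sum//; last exact: bounded_mfun_sum.
rewrite birkhoff_avgZ; apply: cvgM; first exact: cvg_cst.
rewrite birkhoff_avg_sum; apply: (cvg_big add_continuous) => i _; rewrite Rintegral_indic//.
by have := cvg_c (pickle (n.+1, val i)); rewrite /c pickleK.
Qed.

Lemma ae_ergodic_component (f : X -> R) : bounded_mfun (f : Borel rho -> R) ->
  {ae mu, forall x, exists2 nu : probability (Borel rho) R, ergodic rho T nu &
    avg f x @ \oo --> \int[nu]_y f y}.
Proof.
move=> bf; have [_ /bounded_fun_leP[M fM]] := bf; pose C := M + 1.
have C0 : 0 < C by have := le_trans (normr_ge0 _) (fM point); rewrite /C; lra.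
have C20 : 0 < 2 * C by rewrite mulr_gt0.
pose g y := (2 * C)^-1 * (f y + C).
have bC : bounded_mfun (cst C : Borel rho -> R) by exact: bounded_mfun_cst.
have bg : bounded_mfun (g : Borel rho -> R) by apply: bounded_mfunZ; exact: bounded_mfunD bf bC.
have g01 y : 0 <= g y <= 1.
  have := fM y; rewrite ler_norml => /andP[? ?].
  rewrite mulr_ge0 ?invr_ge0 ?(ltW C20)//= ?ler_pdivrMl ?mulr1// /C; lra.
have fE y : f y = (2 * C) * g y - C by rewrite /g mulVKf ?gt_eqF// addrK.
apply: (@filterS _ _ (ae_filter_ringOfSetsType mu) _ _ _ (ae_ergodic_component_unit bg.1 g01)).
move=> x [nu nu_erg g_cvg]; exists nu => //.
have -> : f = (fun y => (2 * C) * g y) \+ cst (- C) by apply/funext.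
rewrite bounded_RintegralD; [|exact: bounded_mfunZ|exact: bounded_mfun_cst].
rewrite bounded_RintegralZ// Rintegral_probability_cst birkhoff_avgD birkhoff_avgZ.
apply: cvgD; last exact: birkhoff_avg_cst_cvg.
by apply: cvgM => //; exact: cvg_cst.
Qed.

Lemma ergodic_Rintegral_gt (f : X -> R) (e : R) : bounded_mfun (f : Borel rho -> R) -> 0 < e ->
  exists2 nu : probability (Borel rho) R, ergodic rho T nu &
    \int[mu]_y f y - e < \int[nu]_y f y.
Proof.
move=> bf e0; have mT := measurable_rho_continuous cT.
have [int_limsup _] := birkhoff mT muT bf.
have [||x [nu nu_erg f_cvg] lt_lim] := @ae_exists_gt _ (Borel rho) R mu _ (limsup f)
  (\int[mu]_y f y - e) (ae_ergodic_component bf).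
- exact: bounded_mfun_birkhoff_limsup.
- by rewrite int_limsup; lra.
by exists nu => //; rewrite -(birkhoff_limsupE f_cvg).
Qed.

End ErgodicComponents.

(** * Tracing and linking closed orbits *)

Section LipschitzBounded.
Variables (R : realType) (X : pointedType) (rho : X -> X -> R).
Implicit Types (f g : X -> R) (C : R).

Definition lipschitz_bounded C f :=
  (forall x y, `|f x - f y| <= C * rho x y) /\ (forall x, `|f x| <= C).

Lemma lipschitz_bounded_ge0 C f : lipschitz_bounded C f -> 0 <= C.
Proof. by move=> [_ fC]; exact: le_trans (fC point). Qed.

Hypothesis rhoM : is_metric rho.

Lemma lipschitz_bounded_le C C' f : C <= C' -> lipschitz_bounded C f -> lipschitz_bounded C' f.
Proof.
move=> CC' [Lf fC]; split=> [x y|x]; last exact: le_trans CC'.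
by apply: le_trans (Lf x y) _; rewrite ler_wpM2r// rho_ge0.
Qed.

Lemma lipschitz_bounded_cst (c : R) : lipschitz_bounded `|c| (cst c).
Proof. by split=> [x y|x] //=; rewrite subrr normr0 mulr_ge0// rho_ge0. Qed.

Lemma lipschitz_boundedD C C' f g : lipschitz_bounded C f -> lipschitz_bounded C' g ->
  lipschitz_bounded (C + C') (f \+ g).
Proof.
move=> [Lf fC] [Lg gC']; split=> [x y|x].
  by rewrite /= opprD addrACA mulrDl; exact: le_trans (ler_normD _ _) (lerD (Lf x y) (Lg x y)).
exact: le_trans (ler_normD _ _) (lerD (fC x) (gC' x)).
Qed.

Lemma lipschitz_boundedZ C (c : R) f : lipschitz_bounded C f ->
  lipschitz_bounded (`|c| * C) (fun x => c * f x).
Proof.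
move=> [Lf fC]; split=> [x y|x]; last by rewrite normrM ler_wpM2l.
by rewrite -mulrBr normrM -mulrA ler_wpM2l.
Qed.

Lemma lipschitz_bounded_sum (J : Type) (r : seq J) (C : J -> R) (F : J -> X -> R) :
  (forall i, lipschitz_bounded (C i) (F i)) ->
  lipschitz_bounded (\sum_(i <- r) C i) (fun x => \sum_(i <- r) F i x).
Proof.
move=> LF; elim: r => [|i r Lr].
  rewrite big_nil; under eq_fun do rewrite big_nil.
  by have := lipschitz_bounded_cst 0; rewrite normr0.
have -> : (fun x => \sum_(j <- i :: r) F j x) = F i \+ (fun x => \sum_(j <- r) F j x).
  by apply/funext => x; rewrite big_cons.
by rewrite big_cons; exact: lipschitz_boundedD.
Qed.

Lemma lipschitz_bounded_continuous C f : lipschitz_bounded C f -> rho_continuous_real rho f.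
Proof.
move=> LfC; have C0 := lipschitz_bounded_ge0 LfC; have [Lf _] := LfC.
move=> x e e0; exists (e / (C + 1)); first by rewrite divr_gt0// ltr_wpDl.
move=> y xy; apply: le_lt_trans (Lf x y) _.
apply: (@le_lt_trans _ _ ((C + 1) * rho x y)); first by rewrite ler_wpM2r ?rho_ge0// lerDl.
by rewrite mulrC -ltr_pdivlMr// ltr_wpDl.
Qed.

Lemma lipschitz_bounded_mfun C f : lipschitz_bounded C f -> bounded_mfun (f : Borel rho -> R).
Proof.
move=> LfC; apply: rho_continuous_real_bounded_mfun; first exact: lipschitz_bounded_continuous LfC.
by apply/bounded_fun_leP; exists C; case: LfC.
Qed.

End LipschitzBounded.

Section PeriodicSums.
Variables (R : realType) (X : Type) (T : X -> X).
Implicit Types (f : X -> R) (q n : nat) (C D d e A : R).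

Local Notation S := (birkhoff_sum T).

Lemma birkhoff_sum_periodic_dist C f q x n : iter q T x = x -> (0 < q)%N ->
  (forall y, `|f y| <= C) -> `|S f x n - n%:R * birkhoff_avg T f x q| <= 2 * C * q%:R.
Proof.
move=> qx q0 fC; have C0 : 0 <= C by exact: le_trans (fC x).
have -> : S f x n - n%:R * birkhoff_avg T f x q =
    S f x (n %% q) - (n %% q)%:R * birkhoff_avg T f x q.
  rewrite (birkhoff_sum_divn f n qx) -(birkhoff_avgK T f x q0).
  by rewrite {3}(divn_eq n q) natrD natrM; ring.
apply: le_trans (ler_normB _ _) _; rewrite normrM normr_nat.
have := normr_birkhoff_sum_le T x (n %% q) fC.
have := ler_wpM2l (ler0n R (n %% q)) (normr_birkhoff_avg_le T x q fC).
have : C * (n %% q)%:R <= C * q%:R by rewrite ler_wpM2l// ler_nat ltnW// ltn_mod.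
lra.
Qed.

Lemma birkhoff_sum_periodic_le C f d q x n : iter q T x = x -> (0 < q)%N ->
  (forall y, `|f y| <= C) -> `|S f x q| <= d * q%:R -> `|S f x n| <= d * n%:R + C * q%:R.
Proof.
move=> qx q0 fC Sq; have C0 : 0 <= C by exact: le_trans (fC x).
have d0 : 0 <= d by rewrite -(@pmulr_lge0 _ q%:R) ?ltr0n//; exact: le_trans Sq.
rewrite (birkhoff_sum_divn f n qx); apply: le_trans (ler_normD _ _) (lerD _ _).
  rewrite normrM normr_nat; apply: le_trans (ler_wpM2l (ler0n _ _) Sq) _.
  by rewrite mulrCA ler_wpM2l// -natrM ler_nat leq_divM.
apply: le_trans (normr_birkhoff_sum_le T x (n %% q) fC) _.
by rewrite ler_wpM2l// ler_nat ltnW// ltn_mod.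
Qed.

(* The error [A] made on each period is absorbed because periods are longer than [p]. *)
Lemma birkhoff_sum_periodic_growth f q x p D A e : iter q T x = x -> (0 < p <= q)%N ->
  0 <= A -> A <= e * p%:R -> (forall n, (n <= q)%N -> `|S f x n| <= D * n%:R + A) ->
  forall n, (p <= n)%N -> `|S f x n| <= (D + 2 * e) * n%:R.
Proof.
move=> qx /andP[p0 pq] A0 Aep SD n pn; have q0 : (0 < q)%N := leq_trans p0 pq.
have e0 : 0 <= e by rewrite -(@pmulr_lge0 _ p%:R) ?ltr0n//; exact: le_trans Aep.
rewrite (birkhoff_sum_divn f n qx); set t := (n %/ q)%N; set s := (n %% q)%N.
have nE : n%:R = t%:R * q%:R + s%:R :> R by rewrite -natrM -natrD -divn_eq.
have Ss : `|S f x s| <= D * s%:R + A by apply: SD; rewrite ltnW// ltn_mod.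
have tSq : t%:R * `|S f x q| <= t%:R * (D * q%:R + A) by rewrite ler_wpM2l// SD.
have tA : t%:R * A + A <= 2 * (e * n%:R).
  have en : 0 <= e * n%:R by rewrite mulr_ge0.
  have A_en : A <= e * n%:R by apply: le_trans Aep _; rewrite ler_wpM2l// ler_nat.
  suff : t%:R * A <= e * n%:R by lra.
  rewrite nE mulrDr; apply: ler_wpDr; first by rewrite mulr_ge0.
  by rewrite mulrCA ler_wpM2l//; apply: le_trans Aep _; rewrite ler_wpM2l// ler_nat.
apply: le_trans (ler_normD _ _) _; rewrite normrM normr_nat.
have -> : (D + 2 * e) * n%:R = D * (t%:R * q%:R) + D * s%:R + 2 * (e * n%:R) by rewrite nE; ring.
lra.
Qed.

End PeriodicSums.

Section Tracing.
Variables (R : realType) (X : pointedType) (rho : X -> X -> R) (T : X -> X).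
Implicit Types (f : X -> R) (p q n : nat) (x y z : X) (C e d : R).

Local Notation S := (birkhoff_sum T).

Definition traces e p q y z :=
  [/\ (p <= q)%N, q%:R <= (1 + e) * p%:R & bowen_ball rho T y p e z].

Lemma birkhoff_sum_bowen_ball C f e p y z n : lipschitz_bounded rho C f ->
  bowen_ball rho T y p e z -> (n <= p)%N -> `|S f z n - S f y n| <= C * e * n%:R.
Proof.
move=> LfC yz np; have C0 := lipschitz_bounded_ge0 LfC; have [Lf _] := LfC.
rewrite /birkhoff_sum -sumrB; apply: le_trans (ler_norm_sum _ _ _) _.
apply: (@le_trans _ _ (\sum_(j < n) C * e)); last by rewrite sumr_const card_ord mulr_natr.
apply: ler_sum => j _; apply: le_trans (Lf _ _) _; apply: ler_wpM2l => //.
by apply/ltW/yz; exact: leq_trans (ltn_ord j) np.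
Qed.

Lemma birkhoff_sum_traces C f e p q y z n : lipschitz_bounded rho C f -> 0 <= e ->
  traces e p q y z -> (n <= q)%N -> `|S f z n - S f y (minn n p)| <= 2 * C * e * n%:R.
Proof.
move=> LfC e0 [pq qe yz] nq; have C0 := lipschitz_bounded_ge0 LfC; have [_ fC] := LfC.
set a := minn n p; have an : (a <= n)%N by exact: geq_minl.
have overrun : (n - a)%:R <= e * a%:R.
  rewrite /a; case: (leqP n p) => [np|pn]; first by rewrite subnn mulr_ge0.
  have : (n - p)%:R <= (q - p)%:R :> R by rewrite ler_nat leq_sub2r.
  by rewrite [(q - p)%:R]natrB//; lra.
have traced := birkhoff_sum_bowen_ball LfC yz (geq_minr n p); rewrite -/a in traced.
have tail := normr_birkhoff_sum_le T (iter a T z) (n - a) fC.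
rewrite -{1}(subnKC an) birkhoff_sum_add addrAC; apply: le_trans (ler_normD _ _) _.
have Ca : C * (n - a)%:R <= C * (e * a%:R) by rewrite ler_wpM2l.
have Cean : C * (e * a%:R) <= C * (e * n%:R) by rewrite !ler_wpM2l// ler_nat.
lra.
Qed.

Variable K : set X.

Definition closed_orbit q z := [/\ K z, iter q T z = z & (0 < q)%N].

Definition linked e y1 p1 q1 y2 p2 q2 z := [/\ closed_orbit q2 z, (q1 <= q2)%N,
  traces e p1 q1 y1 z & traces e p2 (q2 - q1) y2 (iter q1 T z)].

Lemma linked_lengths e y1 p1 q1 y2 p2 q2 z : linked e y1 p1 q1 y2 p2 q2 z ->
  [/\ (p1 + p2 <= q2)%N & q2%:R <= (1 + e) * (p1 + p2)%:R].
Proof.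
move=> [_ q12 [p1q1 q1e _] [p2q2 q2e _]]; split; first by lia.
by rewrite natrB// in q2e; rewrite natrD; lra.
Qed.

Lemma birkhoff_sum_linked C f e y1 p1 q1 y2 p2 q2 z n : lipschitz_bounded rho C f -> 0 <= e ->
  linked e y1 p1 q1 y2 p2 q2 z -> (n <= q2)%N ->
  `|S f z n - (S f y1 (minn n p1) + S f y2 (minn (n - q1) p2))| <= 2 * C * e * n%:R.
Proof.
move=> LfC e0 [_ q12 tr1 tr2] nq2; have [p1q1 _ _] := tr1.
have -> : S f z n = S f z (minn n q1) + S f (iter q1 T z) (n - q1).
  have [nq1|q1n] := leqP n q1; last by rewrite -birkhoff_sum_add subnKC// ltnW.
  by rewrite (eqP nq1) birkhoff_sum0 addr0.
have := birkhoff_sum_traces LfC e0 tr1 (geq_minr n q1).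
rewrite -minnA (minn_idPr p1q1) => piece1.
have piece2 := birkhoff_sum_traces LfC e0 tr2 (leq_sub2r q1 nq2).
have nE : n%:R = (minn n q1)%:R + (n - q1)%:R :> R by rewrite -natrD; congr (_%:R); lia.
rewrite opprD addrACA nE mulrDr; exact: le_trans (ler_normD _ _) (lerD piece1 piece2).
Qed.

Lemma linked_birkhoff_avg C f e lam y1 r1 y2 r2 p1 q1 p2 q2 z : lipschitz_bounded rho C f ->
  0 <= e -> closed_orbit r1 y1 -> closed_orbit r2 y2 -> linked e y1 p1 q1 y2 p2 q2 z ->
  0 <= lam <= 1 -> `|p1%:R - lam * (p1 + p2)%:R| <= e * (p1 + p2)%:R ->
  `|S f z q2 - q2%:R *
      (lam * birkhoff_avg T f y1 r1 + (1 - lam) * birkhoff_avg T f y2 r2)| <=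
  5 * C * e * q2%:R + 2 * C * (r1 + r2)%:R.
Proof.
move=> LfC e0 [_ y1r r10] [_ y2r r20] lnk /andP[lam0 lam1] ratio.
have C0 := lipschitz_bounded_ge0 LfC; have [_ fC] := LfC.
have [p12q2 q2e] := linked_lengths lnk.
have [_ q12 [p1q1 _ _] [p2q2 _ _]] := lnk.
have := birkhoff_sum_linked LfC e0 lnk (leqnn q2).
rewrite (minn_idPr (leq_trans p1q1 q12)) (minn_idPr p2q2) => sum_split.
have dist1 := birkhoff_sum_periodic_dist p1 y1r r10 fC.
have dist2 := birkhoff_sum_periodic_dist p2 y2r r20 fC.
have avg1 := normr_birkhoff_avg_le T y1 r1 fC; have avg2 := normr_birkhoff_avg_le T y2 r2 fC.
move: (birkhoff_avg T f y1 r1) (birkhoff_avg T f y2 r2) dist1 dist2 avg1 avg2 => a1 a2.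
move=> dist1 dist2 avg1 avg2; set v := lam * a1 + (1 - lam) * a2.
have v_le : `|v| <= C.
  have colam0 : 0 <= 1 - lam by rewrite subr_ge0.
  apply: le_trans (ler_normD _ _) _; rewrite !normrM (ger0_norm lam0) (ger0_norm colam0).
  by have := ler_wpM2l lam0 avg1; have := ler_wpM2l colam0 avg2; lra.
have ratio_err : `|(p1%:R - lam * (p1 + p2)%:R) * (a1 - a2)| <= e * (p1 + p2)%:R * (2 * C).
  by rewrite normrM ler_pM//; apply: le_trans (ler_normB _ _) _; lra.
have overrun_err : `|(q2%:R - (p1 + p2)%:R) * v| <= e * (p1 + p2)%:R * C.
  by rewrite normrM ler_pM// ger0_norm ?subr_ge0 ?ler_nat//; lra.
have Cep : C * (e * (p1 + p2)%:R) <= C * (e * q2%:R) by rewrite !ler_wpM2l// ler_nat.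
have -> : S f z q2 - q2%:R * v = (S f z q2 - (S f y1 p1 + S f y2 p2))
    + (S f y1 p1 - p1%:R * a1) + (S f y2 p2 - p2%:R * a2)
    + (p1%:R - lam * (p1 + p2)%:R) * (a1 - a2) - (q2%:R - (p1 + p2)%:R) * v.
  by rewrite /v natrD; ring.
rewrite [(r1 + r2)%:R]natrD.
do 4 (apply: le_trans (ler_normD _ _) _; rewrite -lerBrDr); rewrite normrN; lra.
Qed.

Lemma linked_birkhoff_sum_le C f e d y1 r1 y2 r2 p1 q1 p2 q2 z n : lipschitz_bounded rho C f ->
  0 <= e -> closed_orbit r1 y1 -> closed_orbit r2 y2 -> linked e y1 p1 q1 y2 p2 q2 z ->
  `|S f y1 r1| <= d * r1%:R -> `|S f y2 r2| <= d * r2%:R -> (n <= q2)%N ->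
  `|S f z n| <= (d + 2 * C * e) * n%:R + C * (r1 + r2)%:R.
Proof.
move=> LfC e0 [_ y1r r10] [_ y2r r20] lnk Sr1 Sr2 nq2; have [_ fC] := LfC.
have d0 : 0 <= d by rewrite -(@pmulr_lge0 _ r1%:R) ?ltr0n//; exact: le_trans Sr1.
have sum_split := birkhoff_sum_linked LfC e0 lnk nq2.
have Sn1 := birkhoff_sum_periodic_le (minn n p1) y1r r10 fC Sr1.
have Sn2 := birkhoff_sum_periodic_le (minn (n - q1) p2) y2r r20 fC Sr2.
have pieces : d * (minn n p1)%:R + d * (minn (n - q1) p2)%:R <= d * n%:R.
  have [_ _ [p1q1 _ _] _] := lnk.
  by rewrite -mulrDr -natrD ler_wpM2l// ler_nat; lia.
rewrite natrD -(subrK (S f y1 (minn n p1) + S f y2 (minn (n - q1) p2)) (S f z n)).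
apply: le_trans (ler_normD _ _) _.
by have := ler_normD (S f y1 (minn n p1)) (S f y2 (minn (n - q1) p2)); lra.
Qed.

End Tracing.

Section SmallDenominators.
Variable R : realType.
Implicit Types (a e : R) (m j N : nat).

Lemma dist_half_integer m j : 2^-1 <= `|m%:R - (j%:R + 2^-1)| :> R.
Proof.
rewrite ler_normr; apply/orP; case: (ltnP j m) => [|mj].
  by rewrite -(ler_nat R) -natr1 => jm; left; lra.
by right; move: mj; rewrite -(ler_nat R) => mj; lra.
Qed.

(* The centre [b] is a half-integer multiple of [1 / B], with [B] a common multiple of the
   denominators. *)
Lemma isolated_from_small_denominators a e N : 0 <= a -> 0 < e ->
  exists b d : R, [/\ `|b - a| <= e, 0 < d &
    forall m s, (0 < s <= N)%N -> d < `|m%:R / s%:R - b|].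
Proof.
move=> a0 e0; pose B := (N`! * (Num.bound e^-1))%N.
have bound_gt0 : (0 < Num.bound e^-1)%N.
  rewrite -(ltr_nat R); apply: lt_trans (archi_boundP _); rewrite ?invr_ge0 ?invr_gt0// ltW//.
have B_gt0 : (0 < B)%N by rewrite muln_gt0 fact_gt0.
have B0 : 0 < B%:R :> R by rewrite ltr0n.
have invB_le : B%:R^-1 <= e.
  rewrite -[e]invrK lef_pV2 ?posrE ?invr_gt0//.
  apply: le_trans (ltW (archi_boundP _)) _; first by rewrite invr_ge0 ltW.
  by rewrite ler_nat leq_pmull// fact_gt0.
have /andP[trunc_le lt_trunc] := truncn_itv (mulr_ge0 a0 (ltW B0)).
pose j := Num.truncn (a * B%:R); exists ((j%:R + 2^-1) / B%:R), (4 * B%:R)^-1; split.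
- apply: le_trans invB_le; rewrite -[a](mulfK (lt0r_neq0 B0)) -mulrBl normrM.
  rewrite [X in _ * X]gtr0_norm ?invr_gt0// ler_piMl ?invr_ge0 ?(ltW B0)//.
  by move: lt_trunc; rewrite -natr1 ler_norml => ?; apply/andP; split; rewrite -/j; lra.
- by rewrite invr_gt0 mulr_gt0.
- move=> m s /andP[s0 sN]; have sR0 : s%:R != 0 :> R by rewrite pnatr_eq0 -lt0n.
  have /dvdnP[t BE] : (s %| B)%N by apply/dvdn_mulr/dvdn_fact; rewrite s0.
  have t0 : t%:R != 0 :> R by move: B_gt0; rewrite BE muln_gt0 pnatr_eq0 -lt0n => /andP[].
  have -> : m%:R / s%:R - (j%:R + 2^-1) / B%:R = ((m * t)%:R - (j%:R + 2^-1)) / B%:R :> R.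
    by rewrite BE !natrM; field; apply/andP.
  rewrite normrM [X in _ < _ * X]gtr0_norm ?invr_gt0// invfM ltr_pM2r ?invr_gt0//.
  by apply: lt_le_trans (dist_half_integer _ _); lra.
Qed.

End SmallDenominators.

Section Linking.
Variables (R : realType) (X : pointedType) (rho : X -> X -> R) (T : X -> X).
Variable K : set X.
Hypothesis lK : linkable rho T K.
Implicit Types (e lam C eta : R).

Local Notation S := (birkhoff_sum T).
Local Notation avg := (birkhoff_avg T).
Local Notation closed_orbit := (closed_orbit T K).

Lemma traces_le e e' p q y z : e <= e' -> traces rho T e p q y z -> traces rho T e' p q y z.
Proof.
move=> ee' [pq qe yz]; split=> // [|j jp]; last exact: lt_le_trans (yz j jp) ee'.
by apply: le_trans qe _; rewrite ler_wpM2r// lerD2l.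
Qed.

Lemma linkable_linked y1 y2 e lam : K y1 -> K y2 -> 0 < e -> 0 <= lam <= 1 ->
  exists p1 q1 p2 q2 z, [/\ linked rho T K e y1 p1 q1 y2 p2 q2 z, (0 < p1 + p2)%N &
    `|p1%:R / (p1 + p2)%:R - lam| <= e].
Proof.
move=> Ky1 Ky2 e0 lam01; have [_ /(_ y1 y2 Ky1 Ky2 e lam e0 lam01)] := lK.
move=> [p1 [p2 [q1 [q2 [p10 [p20 [_ [q20 [z [Kz zq ratio tr1 tr2]]]]]]]]]].
exists p1, q1, p2, q2, z; split; [split=> //|by rewrite addn_gt0 p10|].
  by have [p2q2 _ _] := tr2; rewrite ltnW// -subn_gt0 (leq_trans p20).
by rewrite ler_distl.
Qed.

(* Linkability does not bound [p1] from below; prescribing a ratio that is isolated from the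
   fractions with small denominator does. *)
Lemma linkable_linked_long y1 y2 e lam N : K y1 -> K y2 -> 0 < e -> 0 < lam < 1 ->
  exists p1 q1 p2 q2 z, [/\ linked rho T K e y1 p1 q1 y2 p2 q2 z, (N <= p1)%N &
    `|p1%:R - lam * (p1 + p2)%:R| <= e * (p1 + p2)%:R].
Proof.
move=> Ky1 Ky2 e0 /andP[lam0 lam1].
pose e1 := Num.min (e / 2) (Num.min (lam / 4) (1 - lam)).
have e10 : 0 < e1 by rewrite !lt_min !divr_gt0// subr_gt0.
have [e1_e e1_lam e1_lam'] : [/\ e1 <= e / 2, e1 <= lam / 4 & e1 <= 1 - lam].
  by rewrite /e1 !ge_min !lexx ?orbT; split.
pose N' := Num.bound (N%:R / (lam / 2)).
have N'_gt : N%:R / (lam / 2) < N'%:R by apply: archi_boundP; rewrite divr_ge0// divr_ge0// ltW.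
have [b [d [ba d0 isolated]]] := isolated_from_small_denominators N' (ltW lam0) e10.
have /andP[b_ge b_le] : lam - e1 <= b <= lam + e1 by rewrite -ler_distl.
have b01 : 0 <= b <= 1 by apply/andP; split; lra.
have ed0 : 0 < Num.min d e1 by rewrite lt_min d0.
have ed_d : Num.min d e1 <= d by rewrite ge_min lexx.
have ed_e1 : Num.min d e1 <= e1 by rewrite ge_min lexx orbT.
have [p1 [q1 [p2 [q2 [z [[zorb q12 tr1 tr2] s0 ratio]]]]]] := linkable_linked Ky1 Ky2 ed0 b01.
have sR0 : 0 < (p1 + p2)%:R :> R by rewrite ltr0n.
have N'_s : (N' < p1 + p2)%N.
  rewrite ltnNge; apply/negP => sN'; have := isolated p1 (p1 + p2)%N; rewrite s0 sN' => /(_ isT).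
  by rewrite ltNge (le_trans ratio).
have /andP[ratio_ge ratio_le] : b - e1 <= p1%:R / (p1 + p2)%:R <= b + e1.
  by rewrite -ler_distl (le_trans ratio).
exists p1, q1, p2, q2, z; split.
- by split=> //; [apply: traces_le tr1|apply: traces_le tr2]; lra.
- rewrite -(ler_nat R) -[p1%:R](divfK (lt0r_neq0 sR0)).
  apply: (@le_trans _ _ (lam / 2 * (p1 + p2)%:R)); last by rewrite ler_pM2r//; lra.
  rewrite mulrC -ler_pdivrMr ?divr_gt0//; apply: ltW; apply: lt_trans N'_gt _.
  by rewrite ltr_nat.
- rewrite -[p1%:R in X in X <= _](divfK (lt0r_neq0 sR0)) -mulrBl normrM (gtr0_norm sR0).
  by rewrite ler_pM2r// ler_norml; apply/andP; split; lra.
Qed.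

Variables (f : nat -> X -> R) (k : nat) (C : R).
Hypothesis LfC : forall i, (i < k)%N -> lipschitz_bounded rho C (f i).
Hypothesis C0 : 0 <= C.

Lemma closed_orbit_convex y1 r1 y2 r2 lam eta :
  closed_orbit r1 y1 -> closed_orbit r2 y2 -> 0 < lam < 1 -> 0 < eta ->
  exists z q, closed_orbit q z /\ forall i, (i < k)%N ->
    `|avg (f i) z q - (lam * avg (f i) y1 r1 + (1 - lam) * avg (f i) y2 r2)| <= eta.
Proof.
move=> orb1 orb2 lam01 eta0; have [Ky1 _ _] := orb1; have [Ky2 _ _] := orb2.
have [lam0 lam1] := andP lam01; have lam01' : 0 <= lam <= 1 by rewrite !ltW.
pose e := eta / (5 * C + 1); have C51 : 0 < 5 * C + 1 by rewrite ltr_wpDl// mulr_ge0.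
have e0 : 0 < e by rewrite divr_gt0.
pose N := Num.bound (2 * C * (r1 + r2)%:R / e).
have N_gt : 2 * C * (r1 + r2)%:R < e * N%:R.
  rewrite [e * _]mulrC -ltr_pdivrMr//; apply: archi_boundP.
  by rewrite divr_ge0 ?(ltW e0)// !mulr_ge0.
have [p1 [q1 [p2 [q2 [z [lnk Np1 ratio]]]]]] := linkable_linked_long N Ky1 Ky2 e0 lam01.
have [zorb _ _ _] := lnk; exists z, q2; split=> // i ik.
have [_ _ q20] := zorb; have q2R0 : 0 < q2%:R :> R by rewrite ltr0n.
have [p12q2 _] := linked_lengths lnk.
have := linked_birkhoff_avg (LfC ik) (ltW e0) orb1 orb2 lnk lam01' ratio.
rewrite -(birkhoff_avgK _ _ _ q20) -mulrBr normrM normr_nat => dist.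
rewrite -(ler_pM2l q2R0); apply: le_trans dist _.
have -> : q2%:R * eta = 5 * C * e * q2%:R + e * q2%:R.
  by rewrite -[eta](divfK (lt0r_neq0 C51)) -/e; ring.
rewrite lerD2l; apply: le_trans (ltW N_gt) _; rewrite ler_pM2l// ler_nat.
exact: leq_trans Np1 (leq_trans (leq_addr _ _) p12q2).
Qed.

Lemma linked_birkhoff_sum_period g e lam eta y1 y2 r p1 q1 p2 q2 z :
  lipschitz_bounded rho C g -> 0 <= e -> closed_orbit r y2 ->
  linked rho T K e y1 p1 q1 y2 p2 q2 z ->
  `|S g y2 r| <= eta * r%:R ->
  `|p1%:R - lam * (p1 + p2)%:R| <= e * (p1 + p2)%:R -> 0 <= lam -> C * r%:R <= e * p1%:R ->
  `|S g z q2| <= (eta + C * lam + (3 * C + 1) * e) * q2%:R.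
Proof.
move=> LgC e0 [_ y2r r0] lnk Sr ratio lam0 r_small; have [_ gC] := LgC.
have eta0 : 0 <= eta by rewrite -(@pmulr_lge0 _ r%:R) ?ltr0n//; exact: le_trans Sr.
have [p12q2 _] := linked_lengths lnk; have [_ q12 [p1q1 _ _] [p2q2 _ _]] := lnk.
have := birkhoff_sum_linked LgC e0 lnk (leqnn q2).
rewrite (minn_idPr (leq_trans p1q1 q12)) (minn_idPr p2q2) => sum_split.
have S1 := normr_birkhoff_sum_le T y1 p1 gC.
have S2 := birkhoff_sum_periodic_le p2 y2r r0 gC Sr.
have p1_le : C * p1%:R <= C * ((lam + e) * q2%:R).
  rewrite ler_wpM2l//; apply: (@le_trans _ _ ((lam + e) * (p1 + p2)%:R)).
    by move: ratio; rewrite ler_norml => /andP[_]; lra.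
  by rewrite ler_wpM2l ?addr_ge0// ler_nat.
have p2_le : eta * p2%:R <= eta * q2%:R by rewrite ler_wpM2l// ler_nat; lia.
have r_le : C * r%:R <= e * q2%:R.
  by apply: le_trans r_small _; rewrite ler_wpM2l// ler_nat; lia.
rewrite -(subrK (S g y1 p1 + S g y2 p2) (S g z q2)).
apply: le_trans (ler_normD _ _) _; have := ler_normD (S g y1 p1) (S g y2 p2); lra.
Qed.

(* [w'] follows [w] for a time [P] and then [z] for a much longer time: its sums over a whole
   period are as small as those of [z], and in between they are not worse than those of [w]. *)
Lemma closed_orbit_improve w q z r eta N : closed_orbit q w -> closed_orbit r z -> 0 < eta ->
  (forall i, (i < k)%N -> `|S (f i) z r| <= eta * r%:R) ->
  exists w' q' P, [/\ closed_orbit q' w', (N <= P)%N, bowen_ball rho T w P eta w' &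
    forall i, (i < k)%N -> `|S (f i) w' q'| <= 2 * eta * q'%:R /\
      forall d, eta <= d -> `|S (f i) w q| <= d * q%:R ->
        forall n, (P <= n)%N -> `|S (f i) w' n| <= (d + eta) * n%:R].
Proof.
move=> worb zorb eta0 Sz; have [Kw _ _] := worb; have [Kz _ _] := zorb.
pose e := eta / (2 * (3 * C + 2)).
have e0 : 0 < e by rewrite divr_gt0// mulr_gt0// ltr_wpDl// mulr_ge0.
have eE : 2 * (3 * C + 2) * e = eta.
  by rewrite mulrC divfK// gt_eqF// mulr_gt0// ltr_wpDl// mulr_ge0.
have Ce0 : 0 <= C * e by rewrite mulr_ge0// ltW.
pose lam := Num.min 2^-1 (eta / (2 * (C + 1))).
have lam01 : 0 < lam < 1 by rewrite lt_min gt_min invr_gt0 ?divr_gt0 ?mulr_gt0 ?ltr_wpDl//=; lra.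
have Clam : C * lam <= eta / 2.
  have -> : eta / 2 = (C + 1) * (eta / (2 * (C + 1))) by field; rewrite gt_eqF// ltr_wpDl.
  by rewrite ler_pM ?lerDl// ?ge_min ?lexx ?orbT// ltW//; case/andP: lam01.
pose N' := maxn N.+1 (Num.bound (C * (q + r)%:R / e)).
have [p1 [q1 [p2 [q2 [w' [lnk N'p1 ratio]]]]]] := linkable_linked_long N' Kw Kz e0 lam01.
have orbits_small : C * (q + r)%:R <= e * p1%:R.
  rewrite [e * _]mulrC -ler_pdivrMr//; apply: le_trans (ltW (archi_boundP _)) _.
    by rewrite divr_ge0 ?(ltW e0)// mulr_ge0.
  by rewrite ler_nat (leq_trans (leq_maxr N.+1 _) N'p1).
have Np1 : (N < p1)%N := leq_trans (leq_maxl _ _) N'p1.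
have [w'orb _ [_ _ w'w] _] := lnk; have [_ w'q2 _] := w'orb.
have [p12q2 _] := linked_lengths lnk.
exists w', q2, p1; split=> [//||j jp|i ik]; first exact: ltnW.
  by apply: lt_le_trans (w'w j jp) _; lra.
split=> [|d eta_d Sw n p1n].
  have r_le : C * r%:R <= e * p1%:R.
    by apply: le_trans orbits_small; rewrite ler_wpM2l// ler_nat leq_addl.
  have := linked_birkhoff_sum_period (LfC ik) (ltW e0) zorb lnk (Sz i ik) ratio _ r_le.
  move=> /(_ (ltW (andP lam01).1))/le_trans; apply; rewrite ler_wpM2r//; lra.
have Sz_d : `|S (f i) z r| <= d * r%:R by apply: le_trans (Sz i ik) _; rewrite ler_wpM2r.
have p1q2 : (0 < p1 <= q2)%N by apply/andP; split; lia.
have A0 : 0 <= C * (q + r)%:R by rewrite mulr_ge0.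
have := birkhoff_sum_periodic_growth w'q2 p1q2 A0 orbits_small
  (fun n => linked_birkhoff_sum_le (LfC ik) (ltW e0) worb zorb lnk Sw Sz_d (n := n)) p1n.
by move/le_trans; apply; rewrite ler_wpM2r//; lra.
Qed.

End Linking.

(** * Approximation of invariant measures by closed orbits *)

Section ApproximateConvexity.
Variables (R : realType) (k : nat).
Implicit Types (a u v w : 'I_k -> R) (C lam eta s : R).

Definition dot u v : R := \sum_(i < k) u i * v i.

Lemma dot_self_ge0 u : 0 <= dot u u.
Proof. by apply: sumr_ge0 => i _; rewrite -expr2 sqr_ge0. Qed.

Lemma normr_le_dot_self u i e : 0 <= e -> dot u u <= e ^+ 2 -> `|u i| <= e.
Proof.
move=> e0 uu; rewrite -(ler_pXn2r (n := 2)) ?nnegrE// real_normK ?num_real//.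
apply: le_trans uu; rewrite /dot (bigD1 i) //= -expr2 lerDl.
by apply: sumr_ge0 => j _; rewrite -expr2 sqr_ge0.
Qed.

Lemma dot_self_near u w C eta : (forall i, `|u i| <= C) -> (forall i, `|w i| <= C) ->
  (forall i, `|u i - w i| <= eta) -> dot u u <= dot w w + 2 * k%:R * C * eta.
Proof.
move=> uC wC uw; rewrite -lerBlDl /dot -sumrB.
have -> : 2 * k%:R * C * eta = \sum_(i < k) eta * (C + C).
  by rewrite sumr_const card_ord -[RHS]mulr_natl; ring.
apply: ler_sum => i _; have -> : u i * u i - w i * w i = (u i - w i) * (u i + w i) by ring.
apply: le_trans (ler_norm _) _; rewrite normrM ler_pM//.
exact: le_trans (ler_normD _ _) (lerD (uC i) (wC i)).
Qed.

Lemma dot_self_bound u C : (forall i, `|u i| <= C) -> dot u u <= k%:R * C ^+ 2.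
Proof.
move=> uC; rewrite mulr_natl -[k in leRHS]card_ord -sumr_const; apply: ler_sum => i _.
by rewrite -expr2 -real_normK ?num_real// lerXn2r ?nnegrE// (le_trans _ (uC i)).
Qed.

Lemma dot_self_segment_le a v u C lam eta s :
  (forall i, `|a i| <= C) -> (forall i, `|v i| <= C) -> (forall i, `|u i| <= C) ->
  0 < lam < 1 -> (forall i, `|u i - (lam * a i + (1 - lam) * v i)| <= eta) ->
  0 <= s -> dot v a <= s ->
  dot u u <= dot v v - 2 * lam * (dot v v - s) + 2 * lam ^+ 2 * (k%:R * C ^+ 2)
    + 2 * k%:R * C * eta.
Proof.
move=> aC vC uC /andP[lam0 lam1] u_near s0 va.
pose w i := lam * a i + (1 - lam) * v i; have colam0 : 0 < 1 - lam by rewrite subr_gt0.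
have wC i : `|w i| <= C.
  apply: le_trans (ler_normD _ _) _; rewrite !normrM (gtr0_norm lam0) (gtr0_norm colam0).
  have := ler_wpM2l (ltW lam0) (aC i); have := ler_wpM2l (ltW colam0) (vC i); lra.
apply: le_trans (dot_self_near uC wC u_near) _; rewrite lerD2r.
have -> : dot w w = lam ^+ 2 * dot a a + 2 * lam * (1 - lam) * dot v a + (1 - lam) ^+ 2 * dot v v.
  by rewrite /dot !mulr_sumr -!big_split /=; apply: eq_bigr => i _; rewrite /w; ring.
have aa := ler_wpM2l (sqr_ge0 lam) (dot_self_bound aC).
have vv := ler_wpM2l (sqr_ge0 lam) (dot_self_bound vC).
have lam_va : lam * (1 - lam) * dot v a <= lam * s.
  apply: (@le_trans _ _ (lam * (1 - lam) * s)); first by rewrite ler_wpM2l// mulr_ge0// ltW.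
  by rewrite -mulrA ler_wpM2l ?(ltW lam0)// ler_piMl// gerBl ltW.
have -> : (1 - lam) ^+ 2 * dot v v = dot v v - 2 * lam * dot v v + lam ^+ 2 * dot v v by ring.
lra.
Qed.

Variables (E : set ('I_k -> R)) (C : R).
Hypothesis E_bounded : forall a, E a -> forall i, `|a i| <= C.
Hypothesis E_convex : forall a v lam eta, E a -> E v -> 0 < lam < 1 -> 0 < eta ->
  exists2 u, E u & forall i, `|u i - (lam * a i + (1 - lam) * v i)| <= eta.
Hypothesis E_halfspace : forall v s, 0 < s -> exists2 a, E a & dot v a <= s.

(* A vector of almost minimal norm [> 0] would be shortened by moving it towards a vector
   making an almost obtuse angle with it. *)
Lemma approx_convex_lb_dot_self d : (forall a, E a -> d <= dot a a) ->
  (forall r, d < r -> exists2 v, E v & dot v v < r) -> d <= 0.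
Proof.
move=> d_le near_d; rewrite leNgt; apply/negP => d0.
have [a0 Ea0 _] := E_halfspace (fun=> 0) ltr01.
have C0 : 0 <= k%:R * C.
  rewrite mulr_natl -[k]card_ord -sumr_const sumr_ge0// => i _.
  exact: le_trans (E_bounded Ea0 i).
pose B := k%:R * C ^+ 2; have B0 : 0 <= B by rewrite mulr_ge0// sqr_ge0.
pose lam := Num.min 2^-1 (d / (4 * (B + 1))).
have lam01 : 0 < lam < 1 by rewrite lt_min gt_min invr_gt0 ?divr_gt0 ?mulr_gt0 ?ltr_wpDl//=; lra.
have [lam0 _] := andP lam01.
have lamB : lam * B <= d / 4.
  have -> : d / 4 = d / (4 * (B + 1)) * (B + 1) by field; rewrite gt_eqF// ltr_wpDl.
  by rewrite ler_pM ?lerDl// ?(ltW lam0)// ge_min lexx orbT.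
pose eta := lam * d / (8 * (k%:R * C + 1)).
have eta0 : 0 < eta by rewrite divr_gt0 ?mulr_gt0// ltr_wpDl.
have Ceta : 2 * k%:R * C * eta <= lam * d / 4.
  have -> : lam * d / 4 = 2 * (k%:R * C + 1) * eta.
    by rewrite /eta; field; rewrite gt_eqF// ltr_wpDl.
  by rewrite ler_pM2r//; lra.
have lamd0 : 0 < lam * d by rewrite mulr_gt0.
have [|v Ev vv] := near_d (d + lam * d / 4); first by lra.
have [a Ea va] := E_halfspace v (divr_gt0 d0 (ltr0Sn R 3)).
have [u Eu u_near] := E_convex Ea Ev lam01 eta0.
have d40 : 0 <= d / 4 by rewrite divr_ge0// ltW.
have := dot_self_segment_le (E_bounded Ea) (E_bounded Ev) (E_bounded Eu) lam01 u_near d40 va.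
rewrite -/B expr2 -[2 * (lam * lam) * B]mulrA -[lam * lam * B]mulrA.
have := ler_wpM2l (ltW lam0) lamB; have := ler_wpM2l (ltW lam0) (d_le v Ev).
have := d_le u Eu; move: (dot u u) (dot v v) vv => uu vv vv_lt; lra.
Qed.

Lemma approx_convex_closure0 e : 0 < e -> exists2 a, E a & forall i, `|a i| <= e.
Proof.
move=> e0; pose N : set R := [set dot a a | a in E].
have [a0 Ea0 _] := E_halfspace (fun=> 0) ltr01.
have N_neq0 : N !=set0 by exists (dot a0 a0), a0.
have inf_le a : E a -> inf N <= dot a a.
  by move=> Ea; apply: ge_inf; [exists 0 => _ [v _ <-]; exact: dot_self_ge0|exists a].
have near_inf r : inf N < r -> exists2 v, E v & dot v v < r.
  by move=> /(inf_lt N_neq0)[_ [v Ev <-] vr]; exists v.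
have [|a Ea aa] := near_inf (e ^+ 2).
  by apply: le_lt_trans (approx_convex_lb_dot_self inf_le near_inf) _; rewrite exprn_gt0.
by exists a => // i; apply: normr_le_dot_self; exact: ltW.
Qed.

End ApproximateConvexity.

Section Approximation.
Variables (R : realType) (X : pointedType) (rho : X -> X -> R) (T : X -> X).
Hypotheses (rhoM : is_metric rho) (rhoX : rho_complete rho) (rhoS : rho_separable rho).
Hypothesis cT : rho_continuous rho T.
Variable K : set X.
Hypothesis cK : K_closeable rho T K.

Local Notation S := (birkhoff_sum T).
Local Notation avg := (birkhoff_avg T).
Local Notation closed_orbit := (closed_orbit T K).

Lemma generic_cvg (nu : probability (Borel rho) R) x f : generic rho T nu x ->
  rho_continuous_real rho f -> bounded_fun f ->
  avg f x @ \oo --> \int[nu]_y f y.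
Proof.
move=> gx cf bf; have := gx f cf (proj1 (bounded_fun_leP f) bf).
by rewrite (EFin_Rintegral nu (rho_continuous_real_bounded_mfun cf bf)) => /fine_cvgP[].
Qed.

Lemma ergodic_closed_orbit (nu : probability (Borel rho) R) f C e : ergodic rho T nu ->
  lipschitz_bounded rho C f -> 0 < e ->
  exists z q, closed_orbit q z /\ `|avg f z q - \int[nu]_y f y| <= e.
Proof.
move=> nu_erg LfC e0; have [x [gx cx]] := cK nu_erg; have [_ fC] := LfC.
have C0 := lipschitz_bounded_ge0 LfC; have bf := lipschitz_bounded_mfun rhoM LfC.
set a := \int[nu]_y f y; have aC : `|a| <= C.
  rewrite -[leRHS](Rintegral_probability_cst nu).
  by apply: normr_bounded_Rintegral_le => //; exact: bounded_mfun_cst.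
have e20 : 0 < e / 2 by rewrite divr_gt0.
have [N _ avg_near] : \forall n \near \oo, `|avg f x n - a| < e / 2.
  have := generic_cvg gx (lipschitz_bounded_continuous rhoM LfC) bf.2.
  by move=> /cvgrPdist_lt/(_ _ e20); apply: filterS => n; rewrite distrC.
pose d := e / (6 * C + 2); have C1 : 0 < 6 * C + 2 by rewrite ltr_wpDl// mulr_ge0.
have d0 : 0 < d by rewrite divr_gt0.
have dE : d * (6 * C + 2) = e by rewrite divfK// gt_eqF.
have [p [q [Np pq qd [z [xz Kz zq]]]]] := cx d N.+1 d0 (ltn0Sn N).
have q0 : (0 < q)%N by apply: leq_trans pq; exact: leq_trans Np.
have p0 : (0 < p)%N := leq_trans (ltn0Sn N) Np.
exists z, q; split=> //; have qR0 : 0 < q%:R :> R by rewrite ltr0n.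
rewrite -(ler_pM2l qR0) -[X in X * `|_|](gtr0_norm qR0) -normrM mulrBr birkhoff_avgK//.
have := birkhoff_sum_traces LfC (ltW d0) (And3 pq qd xz) (leqnn q).
rewrite (minn_idPr pq) => traced.
have Sp : `|S f x p - p%:R * a| <= e / 2 * p%:R.
  rewrite -(birkhoff_avgK _ _ _ p0) -mulrBr normrM normr_nat mulrC ler_wpM2r//.
  by apply/ltW/avg_near => /=; exact: ltnW.
have overrun : `|(q%:R - p%:R) * a| <= d * p%:R * C.
  by rewrite normrM ler_pM// ger0_norm ?subr_ge0 ?ler_nat//; lra.
have pqR : p%:R <= q%:R :> R by rewrite ler_nat.
have dC : d * p%:R * C <= d * q%:R * C by rewrite ler_wpM2r// ler_pM2l.
have dqC : 0 <= d * q%:R by rewrite mulr_ge0// ltW.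
have -> : S f z q - q%:R * a = (S f z q - S f x p) + (S f x p - p%:R * a) - (q%:R - p%:R) * a.
  by ring.
have e_q : q%:R * e = e / 2 * q%:R + (3 * C + 1) * (d * q%:R) by rewrite -dE; field.
have e_p : e / 2 * p%:R <= e / 2 * q%:R by rewrite ler_pM2l.
do 2 (apply: le_trans (ler_normD _ _) _; rewrite -lerBrDr); rewrite normrN; lra.
Qed.

Hypothesis lK : linkable rho T K.
Variables (f : nat -> X -> R) (k : nat) (C : R).
Hypothesis LfC : forall i, (i < k)%N -> lipschitz_bounded rho C (f i).
Hypothesis C0 : 0 <= C.
Variable mu : probability (Borel rho) R.
Hypothesis muT : invariant_prob rho T mu.
Hypothesis f_mean0 : forall i, (i < k)%N -> \int[mu]_y f i y = 0.

Let orbit_avgs : set ('I_k -> R) :=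
  [set a | exists z q, closed_orbit q z /\ a = fun i : 'I_k => avg (f i) z q].

Let orbit_avgs_halfspace v s : 0 < s -> exists2 a, orbit_avgs a & dot v a <= s.
Proof.
move=> s0; have s20 : 0 < s / 2 by rewrite divr_gt0.
have Lf (i : 'I_k) := LfC (ltn_ord i).
pose g y := \sum_(i < k) v i * f i y.
have Lg : lipschitz_bounded rho (\sum_(i < k) `|v i| * C) g.
  by apply: lipschitz_bounded_sum => // i; exact: lipschitz_boundedZ.
have bg := lipschitz_bounded_mfun rhoM Lg.
have bf (i : 'I_k) := lipschitz_bounded_mfun rhoM (Lf i).
have g_mean0 : \int[mu]_y g y = 0.
  rewrite bounded_Rintegral_sum => [|i]; last exact: bounded_mfunZ.
  by rewrite big1// => i _; rewrite bounded_RintegralZ// f_mean0// mulr0.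
have [nu nu_erg] := ergodic_Rintegral_gt rhoM rhoX rhoS cT muT (bounded_mfunN bg) s20.
rewrite !bounded_RintegralN// g_mean0 => int_g.
have [z [q [zorb avg_g]]] := ergodic_closed_orbit nu_erg Lg s20.
exists (fun i : 'I_k => avg (f i) z q); first by exists z, q.
suff -> : dot v (fun i : 'I_k => avg (f i) z q) = avg g z q.
  by move: avg_g; rewrite ler_norml => /andP[_]; lra.
by rewrite /g birkhoff_avg_sum; apply: eq_bigr => i _; rewrite birkhoff_avgZ.
Qed.

Lemma closed_orbit_avgs_small e : 0 < e ->
  exists z q, closed_orbit q z /\ forall i, (i < k)%N -> `|avg (f i) z q| <= e.
Proof.
move=> e0; have [||a [z [q [zorb ->]]] avg_le] :=
  @approx_convex_closure0 R k orbit_avgs C _ _ orbit_avgs_halfspace e e0.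
- by move=> _ [z [q [_ ->]]] i; apply: normr_birkhoff_avg_le; case: (LfC (ltn_ord i)).
- move=> _ _ lam eta [y [r [yorb ->]]] [z [q [zorb ->]]] lam01 eta0.
  have [u [p [uorb u_near]]] := closed_orbit_convex lK LfC C0 yorb zorb lam01 eta0.
  by exists (fun i : 'I_k => avg (f i) u p) => [|i]; [exists u, p|exact: u_near].
by exists z, q; split=> // i ik; exact: avg_le (Ordinal ik).
Qed.

End Approximation.

(** * A countable family of functions detecting genericity *)

Section RationalCones.
Variables (R : realType) (X : pointedType) (rho : X -> X -> R).
Hypothesis rhoM : is_metric rho.

Lemma normr_max_dist_le (a b a' b' : R) :
  `|Num.max a b - Num.max a' b'| <= `|a - a'| + `|b - b'|.
Proof.
have a_dist := ler_norm (a - a'); have b_dist := ler_norm (b - b').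
have a'_dist := ler_norm (a' - a); have b'_dist := ler_norm (b' - b).
rewrite (distrC a' a) in a'_dist; rewrite (distrC b' b) in b'_dist.
have a0 := normr_ge0 (a - a'); have b0 := normr_ge0 (b - b').
by rewrite ler_norml; case: (leP a b) => ab; case: (leP a' b') => a'b'; apply/andP; split; lra.
Qed.

Lemma lipschitz_bounded_max C C' (f g : X -> R) : lipschitz_bounded rho C f ->
  lipschitz_bounded rho C' g -> lipschitz_bounded rho (C + C') (f \max g).
Proof.
move=> LfC LgC'; have [C0 C'0] := (lipschitz_bounded_ge0 LfC, lipschitz_bounded_ge0 LgC').
have [[Lf fC] [Lg gC']] := (LfC, LgC'); split=> [x y|x].
  apply: le_trans (normr_max_dist_le _ _ _ _) _; rewrite mulrDl; exact: lerD.
rewrite /=; have [_|_] := leP (f x) (g x); first by apply: le_trans (gC' x) _; rewrite lerDr.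
by apply: le_trans (fC x) _; rewrite lerDl.
Qed.

Definition cone (x : X) (v s : R) (y : X) : R := Num.max 0 (v - s * rho x y).

Lemma cone_ge0 x v s y : 0 <= cone x v s y.
Proof. by rewrite le_max lexx. Qed.

Lemma lipschitz_bounded_cone x v s : 0 <= s -> lipschitz_bounded rho (`|v| + s) (cone x v s).
Proof.
move=> s0; split=> [y z|y].
  apply: le_trans (normr_max_dist_le _ _ _ _) _; rewrite subrr normr0 add0r.
  have -> : v - s * rho x y - (v - s * rho x z) = s * (rho x z - rho x y) by ring.
  rewrite normrM (ger0_norm s0); apply: (@le_trans _ _ (s * rho y z)); last first.
    by rewrite ler_wpM2r ?rho_ge0// lerDr.
  rewrite ler_wpM2l// ler_norml; have := rho_triangle rhoM x y z.
  by have := rho_triangle rhoM x z y; rewrite (rhoC rhoM z y) => ? ?; apply/andP; split; lra.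
rewrite ger0_norm ?cone_ge0// ge_max addr_ge0//=.
have := ler_norm v; have := mulr_ge0 s0 (rho_ge0 rhoM x y); lra.
Qed.

Variable D : nat -> X.
Hypothesis dD : forall x (e : R), 0 < e -> exists i, rho (D i) x < e.

Definition rational_cone (c : nat * rat * nat) : X -> R := cone (D c.1.1) (ratr c.1.2) c.2%:R.

Definition max_cones (l : seq (nat * rat * nat)) (y : X) : R :=
  \big[Num.max/0]_(c <- l) rational_cone c y.

Lemma max_cones_ge0 l y : 0 <= max_cones l y.
Proof. exact: bigmax_ge_id. Qed.

Lemma lipschitz_bounded_max_cones l : exists C, lipschitz_bounded rho C (max_cones l).
Proof.
elim: l => [|c l [C LlC]].
  exists `|0 : R|; rewrite /max_cones; under eq_fun do rewrite big_nil.
  exact: lipschitz_bounded_cst.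
have LcC := lipschitz_bounded_cone (D c.1.1) (ratr c.1.2) (ler0n R c.2).
exists (`|ratr c.1.2| + c.2%:R + C); have := lipschitz_bounded_max LcC LlC.
by congr lipschitz_bounded; apply/funext => y; rewrite /max_cones big_cons.
Qed.

Lemma rational_cone_approx f x (e : R) : rho_continuous_real rho f -> (forall y, 0 <= f y) ->
  0 < e -> exists c, (forall y, rational_cone c y <= f y) /\ f x - e < rational_cone c x.
Proof.
move=> cf f0 e0; have e30 : 0 < e / 3 by rewrite divr_gt0.
have [d d0 fd] := cf x _ e30.
have [v] : exists v : rat, ratr v \in `]f x - 2 * (e / 3), f x - e / 3[.
  by apply: rat_in_itvoo; lra.
rewrite in_itv /= => /andP[v_gt v_lt].
pose s := (Num.bound (`|ratr v| / (d / 2))).+1.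
have vs : ratr v <= s%:R * (d / 2) :> R.
  rewrite -ler_pdivrMr ?divr_gt0//; apply: (@le_trans _ _ (`|ratr v| / (d / 2))).
    by rewrite ler_pM2r ?invr_gt0 ?divr_gt0// ler_norm.
  apply: le_trans (ltW (archi_boundP _)) _; last by rewrite ler_nat.
  by rewrite divr_ge0// divr_ge0// ltW.
have sR0 : 0 < s%:R :> R by [].
have [|i] := dD x (e := Num.min (d / 2) (e / 3 / s%:R)); first by rewrite lt_min !divr_gt0.
rewrite lt_min => /andP[Dix_d Dix_e].
exists (i, v, s); split=> [y|]; rewrite /rational_cone /cone /=.
  rewrite ge_max f0 /=; have [xy_lt|xy_ge] := ltP (rho x y) d.
    have := fd y xy_lt; rewrite ltr_norml => /andP[_].
    by have := mulr_ge0 (ltW sR0) (rho_ge0 rhoM (D i) y); lra.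
  apply: le_trans (f0 y); rewrite subr_le0; apply: le_trans vs _; rewrite ler_pM2l//.
  by have := rho_triangle rhoM x (D i) y; rewrite (rhoC rhoM x (D i)); lra.
rewrite lt_max; apply/orP; right.
by move: Dix_e; rewrite ltr_pdivlMr// mulrC; lra.
Qed.

Variables (T : X -> X) (mu : probability (Borel rho) R) (w : X).
Hypothesis cones_cvg : forall l,
  birkhoff_avg T (max_cones l) w @ \oo --> \int[mu]_y max_cones l y.

Let bounded_mfun_max_cones l : bounded_mfun (max_cones l : Borel rho -> R).
Proof. by have [C /(lipschitz_bounded_mfun rhoM)] := lipschitz_bounded_max_cones l. Qed.

Lemma max_cones_cvg f M : rho_continuous_real rho f -> (forall y, 0 <= f y <= M) ->
  exists l : nat -> seq (nat * rat * nat), (forall n y, max_cones (l n) y <= f y) /\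
    \int[mu]_y max_cones (l n) y @[n --> \oo] --> \int[mu]_y f y.
Proof.
move=> cf f0M; have f0 y : 0 <= f y by have /andP[] := f0M y.
pose l n := [seq c <- pmap unpickle (iota 0 n) | `[< forall y, rational_cone c y <= f y >]].
have l_le n y : max_cones (l n) y <= f y.
  by rewrite /max_cones big_filter; apply: bigmax_le => // c /asboolP.
exists l; split=> //; apply: (@bounded_Rintegral_cvg_ae _ _ _ _ _ _ M) => [n|n y||].
- exact: bounded_mfun_max_cones.
- by rewrite ger0_norm ?max_cones_ge0// (le_trans (l_le n y))//; have /andP[] := f0M y.
- apply: rho_continuous_real_bounded_mfun => //; apply/bounded_fun_leP; exists M => y.
  by rewrite ger0_norm//; have /andP[] := f0M y.
apply: aeW => y; apply/cvgrPdist_lt => e e0.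
have [c [c_le c_gt]] := rational_cone_approx y cf f0 e0.
exists (pickle c).+1 => // n /= cn; rewrite ger0_norm ?subr_ge0//.
suff : rational_cone c y <= max_cones (l n) y by lra.
apply: (le_bigmax_seq 0 c xpredT (rational_cone ^~ y)) => //.
rewrite mem_filter; apply/andP; split; first exact/asboolP.
rewrite mem_pmap; apply/mapP; exists (pickle c); last by rewrite pickleK.
by rewrite mem_iota add0n.
Qed.

Lemma birkhoff_avg_gt_nonneg f M e : rho_continuous_real rho f -> (forall y, 0 <= f y <= M) ->
  0 < e -> \forall n \near \oo, \int[mu]_y f y - e < birkhoff_avg T f w n.
Proof.
move=> cf f0M e0; have e20 : 0 < e / 2 by rewrite divr_gt0.
have [l [l_le /cvgrPdist_lt/(_ _ e20)[m _ /(_ m (leqnn m)) /= int_l]]] := max_cones_cvg cf f0M.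
have := @cones_cvg (l m) => /cvgrPdist_lt/(_ _ e20); apply: filterS => n avg_l.
have := le_birkhoff_avg T w n (l_le m).
by move: int_l avg_l; rewrite !ltr_norml => /andP[? ?] /andP[? ?]; lra.
Qed.

Lemma birkhoff_avg_gt f M e : rho_continuous_real rho f -> (forall y, `|f y| <= M) ->
  0 < e -> \forall n \near \oo, \int[mu]_y f y - e < birkhoff_avg T f w n.
Proof.
move=> cf fM e0.
have bf := rho_continuous_real_bounded_mfun cf (proj2 (bounded_fun_leP f) (ex_intro _ M fM)).
have cfM : rho_continuous_real rho (f \+ cst M).
  move=> x r /(cf x)[d d0 fd]; exists d => // y /fd.
  by rewrite /= opprD addrACA subrr addr0.
have fM0 y : 0 <= (f \+ cst M) y <= M + M.
  by have := fM y; rewrite ler_norml /= => /andP[? ?]; apply/andP; split; lra.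
have := birkhoff_avg_gt_nonneg cfM fM0 e0.
apply: filterS2 (nbhs_infty_gt 0) => n n0.
rewrite birkhoff_avgD /= birkhoff_avg_cst// bounded_RintegralD//; last exact: bounded_mfun_cst.
by rewrite Rintegral_probability_cst; lra.
Qed.

Lemma generic_max_cones : generic rho T mu w.
Proof.
move=> f cf f_le; have bf := rho_continuous_real_bounded_mfun cf (proj2 (bounded_fun_leP f) f_le).
have [M fM] := f_le.
rewrite (EFin_Rintegral mu bf); apply: cvg_EFin; first exact: nearW.
have cNf : rho_continuous_real rho (\- f).
  by move=> x r /(cf x)[d d0 fd]; exists d => // y /fd; rewrite /= -opprD normrN.
have NfM y : `|(\- f) y| <= M by rewrite normrN.
apply/cvgrPdist_lt => e e0; have := birkhoff_avg_gt cNf NfM e0.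
apply: filterS2 (birkhoff_avg_gt cf fM e0) => n avg_f.
rewrite birkhoff_avgN /= bounded_RintegralN// -/(birkhoff_sum T f w n) -/(birkhoff_avg T f w n).
by move=> avg_Nf; rewrite ltr_norml; apply/andP; split; lra.
Qed.

End RationalCones.

(** * Generic points as limits of linked closed orbits *)

Section Halving.
Variable R : realType.
Implicit Types (c e : R).

Definition halving c j : R := c / 2 ^+ j.

Lemma halving_gt0 c j : 0 < c -> 0 < halving c j.
Proof. by move=> c0; rewrite divr_gt0// exprn_gt0. Qed.

Lemma halvingS c j : halving c j = 2 * halving c j.+1.
Proof. by rewrite /halving exprS; field; rewrite expf_neq0. Qed.

Lemma near_halving_lt c e : 0 < c -> 0 < e -> \forall j \near \oo, halving c j < e.
Proof.
move=> c0 e0; apply: filterS (near_infty_natSinv_expn_lt (PosNum (divr_gt0 e0 c0))) => j /=.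
by rewrite mul1r ltr_pdivlMr// mulrC.
Qed.

End Halving.

Section IncreasingTimes.
Variable P : nat -> nat.
Hypothesis P_lt : forall j, (P j < P j.+1)%N.

Lemma increasing_times_le i j : (i <= j)%N -> (P i <= P j)%N.
Proof. by move/subnK <-; elim: (j - i)%N => // k /leq_trans; apply; exact: ltnW. Qed.

Lemma increasing_times_ge j : (j <= P j)%N.
Proof. by elim: j => // j /leq_ltn_trans; exact. Qed.

Lemma increasing_times_bracket i n : (P i <= n)%N ->
  exists j, [/\ (i <= j)%N, (P j <= n)%N & (n < P j.+1)%N].
Proof.
move=> Pin; have Pn_bound j : (P j <= n)%N -> (j <= n)%N := leq_trans (increasing_times_ge j).
have [j Pj j_max] := ex_maxnP (ex_intro (fun j => P j <= n)%N i Pin) Pn_bound.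
exists j; split=> //; first exact: j_max.
by rewrite ltnNge; apply/negP => /j_max; rewrite ltnn.
Qed.

End IncreasingTimes.

Section ShadowingLimit.
Variables (R : realType) (X : pointedType) (rho : X -> X -> R) (T : X -> X).
Hypotheses (rhoM : is_metric rho) (rhoX : rho_complete rho) (cT : rho_continuous rho T).
Variables (W : nat -> X) (P : nat -> nat) (c : R).
Hypotheses (c0 : 0 < c) (P_lt : forall j, (P j < P j.+1)%N).
Hypothesis W_shadow : forall j, bowen_ball rho T (W j) (P j.+1) (halving c j) (W j.+1).

Local Notation eps := (halving c).

Let W_dist i j t : (i <= j)%N -> (t < P i.+1)%N ->
  rho (iter t T (W j)) (iter t T (W i)) <= 2 * eps i - 2 * eps j.
Proof.
move=> ij tP; rewrite -(subnKC ij); elim: (j - i)%N => [|l IHl].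
  by rewrite addn0 (rhoxx rhoM) subrr.
have tPl : (t < P (i + l).+1)%N.
  by apply: leq_trans tP (increasing_times_le P_lt _); rewrite ltnS leq_addr.
rewrite addnS; apply: le_trans (rho_triangle rhoM _ (iter t T (W (i + l)%N)) _) _.
by have := W_shadow tPl; have := halvingS c (i + l); lra.
Qed.

Lemma shadowing_limit : exists w, forall j, bowen_ball rho T (W j) (P j.+1) (3 * eps j) w.
Proof.
have [w Ww] : exists w, forall e : R, 0 < e ->
    exists N, forall n, (N <= n)%N -> rho (W n) w < e.
  apply: rhoX => e e0; have e40 : 0 < e / 4 by rewrite divr_gt0.
  have [N _ /(_ N (leqnn N)) /= N_lt] := near_halving_lt c0 e40.
  have P0 : (0 < P N.+1)%N := leq_trans (ltn0Sn N) (increasing_times_ge P_lt N.+1).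
  exists N => m n Nm Nn; have := W_dist Nm P0; have := W_dist Nn P0.
  have := rho_triangle rhoM (W m) (W N) (W n); rewrite (rhoC rhoM (W N)) /=.
  by have := halving_gt0 m c0; have := halving_gt0 n c0; lra.
exists w => j t tP; have [d d0 Td] := rho_continuous_iter t cT w (halving_gt0 j c0).
have [N W_near] := Ww d d0; set n := maxn N j.
have w_dist : rho (iter t T w) (iter t T (W n)) < eps j.
  by apply: Td; rewrite (rhoC rhoM); apply: W_near; exact: leq_maxl.
have := W_dist (leq_maxr N j) tP; have := halving_gt0 n c0.
by have := rho_triangle rhoM (iter t T w) (iter t T (W n)) (iter t T (W j)); lra.
Qed.

Lemma shadow_avg_cvg0 f C w i D : lipschitz_bounded rho C f ->
  (forall j, bowen_ball rho T (W j) (P j.+1) (3 * eps j) w) ->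
  (forall j n, (i <= j)%N -> (P j <= n)%N -> `|birkhoff_sum T f (W j) n| <= D * eps j * n%:R) ->
  birkhoff_avg T f w @ \oo --> 0.
Proof.
move=> LfC w_shadow W_small; have C0 := lipschitz_bounded_ge0 LfC.
pose D' := `|D| + 3 * C + 1; have D'0 : 0 < D' by rewrite ltr_wpDl// addr_ge0// mulr_ge0.
apply/cvgr0Pnorm_lt => e e0.
have [N _ N_lt] := near_halving_lt c0 (divr_gt0 e0 D'0).
exists (P (maxn N i)).+1 => // n /= Pn.
have [j [Nij Pjn nPj]] := increasing_times_bracket P_lt (ltnW Pn).
have ij : (i <= j)%N := leq_trans (leq_maxr N i) Nij.
have nR0 : 0 < n%:R :> R by rewrite ltr0n; exact: leq_trans Pn.
have eps0 := halving_gt0 j c0.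
have eps_lt : eps j * D' < e.
  by rewrite -ltr_pdivlMr//; apply: N_lt; exact: leq_trans (leq_maxl N i) Nij.
have sum_dist := birkhoff_sum_bowen_ball LfC (w_shadow j) (ltnW nPj).
have sum_W := W_small j n ij Pjn.
rewrite /birkhoff_avg normrM ger0_norm ?invr_ge0// ltr_pdivrMl//.
rewrite -(subrK (birkhoff_sum T f (W j) n) (birkhoff_sum T f w n)).
apply: le_lt_trans (ler_normD _ _) _; apply: le_lt_trans (lerD sum_dist sum_W) _.
rewrite -mulrDl mulrC ltr_pM2l//; apply: le_lt_trans eps_lt.
have := ler_wpM2r (ltW eps0) (ler_norm D); rewrite /D'; nra.
Qed.

End ShadowingLimit.

Section Construction.
Variables (R : realType) (X : pointedType) (rho : X -> X -> R) (T : X -> X).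
Hypotheses (rhoM : is_metric rho) (rhoX : rho_complete rho) (rhoS : rho_separable rho).
Hypothesis cT : rho_continuous rho T.
Variable K : set X.
Hypotheses (lK : linkable rho T K) (cK : K_closeable rho T K).
Variable mu : probability (Borel rho) R.
Hypothesis muT : invariant_prob rho T mu.

Local Notation S := (birkhoff_sum T).
Local Notation avg := (birkhoff_avg T).

Variables (g : nat -> X -> R) (C : nat -> R).
Hypothesis LgC : forall n, lipschitz_bounded rho (C n) (g n).
Hypothesis g_mean0 : forall n, \int[mu]_y g n y = 0.
Variable c : R.
Hypothesis c0 : 0 < c.

Local Notation eps := (halving c).

(* [time_of] is the length up to which [point_of] shadows the previous stage. *)
Record stage := Stage {
  point_of : X;
  period_of : nat;
  time_of : nat;
  stage_orbit : closed_orbit T K period_of point_of }.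

Definition refines j (st st' : stage) :=
  [/\ (time_of st < time_of st')%N,
    bowen_ball rho T (point_of st) (time_of st') (eps j) (point_of st') &
    forall i, (i < j)%N ->
      `|S (g i) (point_of st') (period_of st')| <= 2 * eps j * (period_of st')%:R /\
      forall d, eps j <= d ->
        `|S (g i) (point_of st) (period_of st)| <= d * (period_of st)%:R ->
        forall n, (time_of st' <= n)%N -> `|S (g i) (point_of st') n| <= (d + eps j) * n%:R].

Lemma refines_exists j st : exists st', refines j st st'.
Proof.
pose Cj := \sum_(i < j) C i.
have C_ge0 n : 0 <= C n := lipschitz_bounded_ge0 (LgC n).
have Cj0 : 0 <= Cj by exact: sumr_ge0.
have LgCj i : (i < j)%N -> lipschitz_bounded rho Cj (g i).
  move=> ij; apply: lipschitz_bounded_le (LgC i) => //.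
  by rewrite /Cj (bigD1 (Ordinal ij)) //= lerDl sumr_ge0.
have [z [r [zorb avg_small]]] := closed_orbit_avgs_small rhoM rhoX rhoS cT cK lK LgCj Cj0 muT
  (fun i _ => g_mean0 i) (halving_gt0 j c0).
have sum_small i : (i < j)%N -> `|S (g i) z r| <= eps j * r%:R.
  have [_ _ r0] := zorb => ij; rewrite -(birkhoff_avgK T _ _ r0) normrM normr_nat mulrC.
  by rewrite ler_wpM2r// avg_small.
have [w [q [P [worb tP shadow small]]]] := closed_orbit_improve lK LgCj Cj0
  (time_of st).+1 (stage_orbit st) zorb (halving_gt0 j c0) sum_small.
by exists (Stage P worb).
Qed.

Lemma stages_exist st0 : exists st : nat -> stage, st 0 = st0 /\
  forall j, refines j (st j) (st j.+1).
Proof.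
have [next nextP] := choice (fun jst : nat * stage => refines_exists jst.1 jst.2).
pose st := fix st j := if j is j'.+1 then next (j', st j') else st0.
by exists st; split=> // j; exact: (nextP (j, st j)).
Qed.

Lemma stages_small (st : nat -> stage) i : (forall j, refines j (st j) (st j.+1)) ->
  forall j n, (i.+3 <= j)%N -> (time_of (st j) <= n)%N ->
  `|S (g i) (point_of (st j)) n| <= 12 * eps j * n%:R.
Proof.
move=> st_refines [|[|j]]// n ij jn.
have [_ _ /(_ i ij)[sum_period _]] := st_refines j.
have [_ _ /(_ i (ltnW ij))[_ growth]] := st_refines j.+1.
have epsS := halvingS c j; have epsSS := halvingS c j.+1; have eps_pos := halving_gt0 j.+1 c0.
apply: le_trans (growth (2 * eps j) _ sum_period n jn) _; first by lra.
by rewrite ler_wpM2r//; lra.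
Qed.

Lemma shadow_with_zero_avgs q y s : closed_orbit T K q y ->
  exists2 w, (forall n, avg (g n) w @ \oo --> 0) & rho (iter s T w) (iter s T y) < 3 * c.
Proof.
move=> yorb; have [st [st0 st_refines]] := stages_exist (Stage s yorb).
have time_lt j : (time_of (st j) < time_of (st j.+1))%N by case: (st_refines j).
have shadow j : bowen_ball rho T (point_of (st j)) (time_of (st j.+1)) (eps j)
  (point_of (st j.+1)) by case: (st_refines j).
have [w w_shadow] := shadowing_limit rhoM rhoX cT c0 time_lt shadow.
exists w => [n|]; last first.
  have := w_shadow 0 s; rewrite st0 /halving expr0 divr1; apply.
  by have := time_lt 0; rewrite st0.
exact: (shadow_avg_cvg0 c0 time_lt (LgC n) w_shadow (stages_small st_refines)).
Qed.

End Construction.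

Section GenericPoints.
Variables (R : realType) (X : pointedType) (rho : X -> X -> R) (T : X -> X).
Hypotheses (rhoM : is_metric rho) (rhoX : rho_complete rho) (rhoS : rho_separable rho).
Hypothesis cT : rho_continuous rho T.
Variable K : set X.
Hypothesis cK : K_closeable rho T K.

Lemma generic_T (mu : probability (Borel rho) R) x : generic rho T mu x -> generic rho T mu (T x).
Proof.
move=> gx f cf /bounded_fun_leP bf; have avg_cvg := generic_cvg gx cf bf.
rewrite (EFin_Rintegral mu (rho_continuous_real_bounded_mfun cf bf)).
apply: cvg_EFin; first exact: nearW.
have avgE : birkhoff_avg T f (T x) =
    (birkhoff_avg T f (T x) \- birkhoff_avg T f x) \+ birkhoff_avg T f x.
  by apply/funext => n; rewrite /= subrK.
suff : birkhoff_avg T f (T x) @ \oo --> \int[mu]_y f y by [].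
by rewrite avgE -[X in _ --> X]add0r; exact: cvgD (birkhoff_avg_shift_cvg T x bf) avg_cvg.
Qed.

Lemma generic_iter (mu : probability (Borel rho) R) s x : generic rho T mu x ->
  generic rho T mu (iter s T x).
Proof. by move=> gx; elim: s => //= s; exact: generic_T. Qed.

Lemma cone1_gt0 x (e : R) y : (0 < cone rho x e 1 y) = (rho x y < e).
Proof. by rewrite lt_max ltxx /= mul1r subr_gt0. Qed.

Lemma measure_center_Rintegral_gt0 x (e : R) : measure_center rho T x -> 0 < e ->
  exists2 nu : probability (Borel rho) R, invariant_prob rho T nu &
    0 < \int[nu]_y cone rho x e 1 y.
Proof.
move=> Cx e0; pose U : set X := [set y | rho x y < e].
have oU : rho_open rho U by rewrite (rho_openE rhoM); exact: open_rho_ball.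
have [nu nuT nuU] : exists2 nu : probability (Borel rho) R,
    invariant_prob rho T nu & nu U <> 0%E.
  apply: contrapT => /forall2NP no_nu; apply: Cx; exists U; split=> //.
    by move=> nu nuT; have [//|/contrapT] := no_nu nu.
  by rewrite /U /= (rhoxx rhoM).
exists nu => //; have bcone := lipschitz_bounded_mfun rhoM (lipschitz_bounded_cone rhoM x e ler01).
rewrite lt_neqAle Rintegral_ge0 ?andbT => [|y _]; last exact: cone_ge0.
rewrite eq_sym; apply/eqP => int0; apply: nuU.
have [N [mN nuN0 cone_N]] := ae_eq0_bounded_Rintegral bcone (cone_ge0 rho x e 1) int0.
apply: (subset_measure0 (B := N)) => //; first exact: sub_sigma_algebra.
by move=> y /= xy; apply: cone_N => /= /eqP; rewrite gt_eqF// cone1_gt0.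
Qed.

Lemma closed_orbit_visits_center x (e : R) : measure_center rho T x -> 0 < e ->
  exists y q s, closed_orbit T K q y /\ rho x (iter s T y) < e.
Proof.
move=> Cx e0; have [nu nuT int_pos] := measure_center_Rintegral_gt0 Cx e0.
have Lcone := lipschitz_bounded_cone rhoM x e ler01.
have bcone := lipschitz_bounded_mfun rhoM Lcone.
have [nu' nu'_erg] := ergodic_Rintegral_gt rhoM rhoX rhoS cT nuT bcone int_pos.
rewrite subrr => int'_pos; have [x0 [gx0 cx0]] := cK nu'_erg.
have [s xs] : exists s, rho x (iter s T x0) < e.
  apply: contrapT => /forallNP no_visit.
  have cone0 j : cone rho x e 1 (iter j T x0) = 0.
    apply/eqP; rewrite eq_le cone_ge0 andbT leNgt cone1_gt0; exact/negP/no_visit.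
  have := generic_cvg gx0 (lipschitz_bounded_continuous rhoM Lcone) bcone.2.
  move=> /cvgrPdist_lt/(_ _ int'_pos)[N _ /(_ N (leqnn N))].
  by rewrite /birkhoff_avg /birkhoff_sum big1// mulr0 subr0 gtr0_norm// ltxx.
have gap : 0 < e - rho x (iter s T x0) by rewrite subr_gt0.
have [p [q [sp pq _ [y [x0y Ky yq]]]]] := cx0 _ s.+1 gap (ltn0Sn s).
exists y, q, s; split; first by split=> //; apply: leq_trans pq; exact: leq_trans sp.
have := x0y s sp; have := rho_triangle rhoM x (iter s T x0) (iter s T y).
by rewrite (rhoC rhoM (iter s T x0)); lra.
Qed.

Hypothesis lK : linkable rho T K.

Lemma generic_near_closed_orbit (mu : probability (Borel rho) R) q y s (e : R) :
  invariant_prob rho T mu -> closed_orbit T K q y -> 0 < e ->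
  exists2 w, generic rho T mu w & rho (iter s T w) (iter s T y) < e.
Proof.
move=> muT yorb e0; have [D dD] := dense_sequence rhoM rhoS.
pose cones n := max_cones rho D (odflt [::] (unpickle n)).
have [C LC] := choice (fun n => lipschitz_bounded_max_cones rhoM D (odflt [::] (unpickle n))).
pose m n := \int[mu]_y cones n y; pose g n := cones n \+ cst (- m n).
have bcones n : bounded_mfun (cones n : Borel rho -> R) := lipschitz_bounded_mfun rhoM (LC n).
have LgC n : lipschitz_bounded rho (C n + `|- m n|) (g n).
  exact: lipschitz_boundedD (LC n) (lipschitz_bounded_cst rhoM _).
have g_mean0 n : \int[mu]_y g n y = 0.
  rewrite bounded_RintegralD//; last exact: bounded_mfun_cst.
  by rewrite Rintegral_probability_cst subrr.
have [w avg0 wy] := shadow_with_zero_avgs rhoM rhoX rhoS cT lK cK muT LgC g_mean0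
  (divr_gt0 e0 (ltr0Sn R 2)) s yorb.
exists w; last by apply: lt_le_trans wy _; lra.
apply: (generic_max_cones rhoM dD) => l.
have conesE : max_cones rho D l = g (pickle l) \+ cst (m (pickle l)).
  by apply/funext => z; rewrite /g /= subrK /cones pickleK.
have -> : \int[mu]_z max_cones rho D l z = 0 + m (pickle l).
  by rewrite add0r /m /cones pickleK.
rewrite conesE birkhoff_avgD; apply: cvgD; [exact: avg0|exact: birkhoff_avg_cst_cvg].
Qed.

End GenericPoints.

Theorem theorem6p2 (R : realType) (X : pointedType) (rho : X -> X -> R) (T : X -> X)
  (K : set X) :
  is_metric rho -> rho_complete rho -> rho_separable rho ->
  rho_continuous rho T -> (forall y : X, exists x : X, T x = y) ->
  linkable rho T K -> K_closeable rho T K ->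
  forall mu : probability (Borel rho) R, invariant_prob rho T mu ->
  forall x : X, measure_center rho T x ->
  forall e : R, 0 < e -> exists2 y : X, generic rho T mu y & rho x y < e.
Proof.
move=> rhoM rhoX rhoS cT _ lK cK mu muT x Cx e e0.
have e20 : 0 < e / 2 by rewrite divr_gt0.
have [y [q [s [yorb xy]]]] := closed_orbit_visits_center rhoM rhoX rhoS cT cK Cx e20.
have [w gw wy] := generic_near_closed_orbit rhoM rhoX rhoS cT cK lK s muT yorb e20.
exists (iter s T w); first exact: generic_iter.
apply: le_lt_trans (rho_triangle rhoM x (iter s T y) (iter s T w)) _.
by rewrite (rhoC rhoM (iter s T y)) [e]splitr ltrD.
Qed.
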